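(* Let $\sigma:[0,\infty)\to[0,\infty)$ be a proper smooth function with $0<\sigma'\le1$, and let $f:\mathbf{E}^n_1\to\mathbf{R}$ be a proper nonnegative strictly convex Lorentzian function. Let $M\subset\mathbf{E}^{n+1}_1$ be the graph of $u=\sigma\circ f:\mathbf{E}^n_1\to\mathbf{R}$ in $\mathbf{E}^n_1\times\mathbf{R}=\mathbf{E}^{n+1}_1$. Then $M$ is a timelike hypersurface of $\mathbf{E}^{n+1}_1$ and is geodesically connected.
   Context: $\mathbf{E}^{m+1}_1$ is Minkowski space: $\mathbf{R}^{m+1}$ with a nondegenerate inner product whose diagonal form has $m$ positives and one negative. A strictly convex function is a smooth function with positive definite Hessian everywhere. A smooth function $f$ on a Lorentzian manifold $Q$ is Lorentzian if its graph in $Q\times\mathbf{R}$ (product metric, standard positive metric on $\mathbf{R}$) is a timelike submanifold (induced metric Lorentzian), i.e. $\langle\nabla f,\nabla f\rangle>-1$. Geodesically connected means any two points are joined by a geodesic of $M$ (with the induced metric), of any causal type. *)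

(* Defs.v *)
From mathcomp Require Import all_boot all_order all_algebra.
From mathcomp Require Import all_classical all_reals all_analysis.

Set Implicit Arguments.
Unset Strict Implicit.
Unset Printing Implicit Defensive.

Import Order.TTheory GRing.Theory Num.Theory.
Import numFieldNormedType.Exports.

Local Open Scope classical_set_scope.
Local Open Scope ring_scope.

Section Smoothness.
Context {R : realType} {V W : normedModType R}.

(* Intended for open [U].  In finite dimension, [f] is C^(k+1) iff it is
   differentiable and all its directional derivatives are C^k. *)
Fixpoint Ck_on (k : nat) (U : set V) (f : V -> W) : Prop :=
  if k is k'.+1 then
    (forall x, U x -> differentiable f x) /\
    (forall v : V, Ck_on k' U (fun x => 'D_v f x))
  else forall x, U x -> {for x, continuous f}.

Definition smooth_on (U : set V) (f : V -> W) : Prop :=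
  forall k, Ck_on k U f.

(* Smoothness on a set [A] that need not be open: [f] restricted to [A] is the
   restriction of a smooth function on an open neighbourhood of [A].  The
   values of [f] outside [A] are irrelevant. *)
Definition smooth_within (A : set V) (f : V -> W) : Prop :=
  exists (U : set V) (s : V -> W),
    [/\ open U, A `<=` U, smooth_on U s & forall x, A x -> s x = f x].

End Smoothness.

(* [f], regarded as a map [A -> B], is proper. *)
Definition proper_map {V W : topologicalType} (A : set V) (B : set W)
    (f : V -> W) : Prop :=
  forall K : set W, K `<=` B -> compact K -> compact (A `&` f @^-1` K).

(* Derivative of [f] regarded as a function on [A]: one-sided at an end point
   of an interval [A], the usual derivative in its interior. *)
Definition derive1_within {R : realType} (A : set R) (f : R -> R) (t : R) : R :=
  lim ((fun h => h^-1 * (f (h + t) - f t))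
         @ within (fun h => A (h + t)) 0^').

Section Minkowski.
Context {R : realType}.

(* The inner product of E^n_1, on row vectors: the coordinate of index 0 is the
   negative one.  It is Lorentzian only for [0 < n]. *)
Definition minkowski_mx (n : nat) : 'M[R]_n :=
  diag_mx (\row_(i < n) (if val i == 0%N then -1 else 1)).

(* Some basis diagonalizes [G] with one -1 and n - 1 times +1. *)
Definition lorentzian_form (n : nat) (G : 'M[R]_n) : Prop :=
  exists2 P : 'M[R]_n, P \in unitmx & P *m G *m P^T = minkowski_mx n.

Definition coord_vec (n : nat) (i : 'I_n) : 'rV[R]_n := delta_mx 0 i.

Definition hessian (n : nat) (f : 'rV[R]_n -> R) (x : 'rV[R]_n) : 'M[R]_n :=
  \matrix_(i, j) 'D_(coord_vec i) (fun y => 'D_(coord_vec j) f y) x.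

Definition positive_definite (n : nat) (H : 'M[R]_n) : Prop :=
  forall v : 'rV[R]_n, v != 0 -> 0 < (v *m H *m v^T) 0 0.

Definition strictly_convex (n : nat) (f : 'rV[R]_n -> R) : Prop :=
  smooth_on setT f /\ forall x, positive_definite (hessian f x).

(* [phi], defined on the open set [U], is a local parametrization of [S]: a
   smooth immersion which is a homeomorphism onto a relatively open part of
   [S].  The rows of the Jacobian ['J phi x] are the partial derivatives. *)
Definition local_param (n N : nat) (S : set 'rV[R]_N) (U : set 'rV[R]_n)
    (phi : 'rV[R]_n -> 'rV[R]_N) : Prop :=
  [/\ open U,
      smooth_on U phi,
      (forall x, U x -> row_free ('J phi x)),
      set_inj U phi
    & forall V : set 'rV[R]_n, open V -> V `<=` U ->
        exists2 W : set 'rV[R]_N, open W & phi @` V = S `&` W].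

Definition submanifold (n N : nat) (S : set 'rV[R]_N) : Prop :=
  forall p, S p -> exists (U : set 'rV[R]_n) (phi : 'rV[R]_n -> 'rV[R]_N),
    local_param S U phi /\ (phi @` U) p.

(* Pullback under [phi] of the inner product of E^N_1: the matrix of
   coefficients g_ij of the induced metric in the coordinates given by [phi]. *)
Definition induced_metric (n N : nat) (phi : 'rV[R]_n -> 'rV[R]_N)
    (x : 'rV[R]_n) : 'M[R]_n :=
  'J phi x *m minkowski_mx N *m ('J phi x)^T.

Definition timelike_submanifold (n N : nat) (S : set 'rV[R]_N) : Prop :=
  submanifold n S /\
  forall (U : set 'rV[R]_n) (phi : 'rV[R]_n -> 'rV[R]_N),
    local_param S U phi ->
    forall x, U x -> lorentzian_form (induced_metric phi x).

Definition timelike_hypersurface (n : nat) (S : set 'rV[R]_(n + 1)) : Prop :=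
  timelike_submanifold n S.

(* Gamma^k_ij of the Levi-Civita connection of the metric [g]. *)
Definition christoffel (n : nat) (g : 'rV[R]_n -> 'M[R]_n) (x : 'rV[R]_n)
    (k i j : 'I_n) : R :=
  2^-1 * \sum_(l < n) invmx (g x) k l *
    ('D_(coord_vec i) (fun y => g y j l) x
     + 'D_(coord_vec j) (fun y => g y i l) x
     - 'D_(coord_vec l) (fun y => g y i j) x).

Definition geodesic_equation (n : nat) (g : 'rV[R]_n -> 'M[R]_n)
    (c : R -> 'rV[R]_n) (t : R) : Prop :=
  forall k : 'I_n,
    derive1n 2 c t 0 k
    + \sum_(i < n) \sum_(j < n)
        christoffel g (c t) k i j * derive1 c t 0 i * derive1 c t 0 j = 0.

(* [gamma], restricted to [0, 1], is a geodesic of the [n]-dimensional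
   submanifold [S] with its induced metric: around each time it reads, in some
   local coordinates of [S], as a smooth solution [c] of the geodesic equation.
   At the times 0 and 1, [c] is a smooth curve on a neighbourhood, but only its
   part over [0, 1] is constrained. *)
Definition geodesic_segment (n N : nat) (S : set 'rV[R]_N)
    (gamma : R -> 'rV[R]_N) : Prop :=
  forall t0 : R, 0 <= t0 <= 1 ->
    exists (U : set 'rV[R]_n) (phi : 'rV[R]_n -> 'rV[R]_N)
           (I : set R) (c : R -> 'rV[R]_n),
      [/\ local_param S U phi,
          open_nbhs t0 I,
          smooth_on I c
        & forall t, I t -> 0 <= t <= 1 ->
            [/\ U (c t), gamma t = phi (c t)
              & geodesic_equation (induced_metric phi) c t]].

Definition geodesically_connected (n N : nat) (S : set 'rV[R]_N) : Prop :=
  forall p q, S p -> S q ->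
    exists gamma : R -> 'rV[R]_N,
      [/\ geodesic_segment n S gamma, gamma 0 = p & gamma 1 = q].

(* The graph in E^n_1 x R = E^(n+1)_1, the factor R being the last coordinate. *)
Definition graph (n : nat) (u : 'rV[R]_n -> R) : set 'rV[R]_(n + 1) :=
  range (fun x => row_mx x (u x)%:M).

Definition lorentzian_function (n : nat) (f : 'rV[R]_n -> R) : Prop :=
  smooth_on setT f /\ timelike_hypersurface (graph f).

End Minkowski.

(* Main.v *)
Require Import Defs.
From mathcomp Require Import all_boot all_order all_algebra.
From mathcomp Require Import all_classical all_reals all_analysis.
From mathcomp Require Import ring lra zify.

(* A geodesic of the graph of u = s o f is a curve (x, u(x)) with
     x'' = - Hess u(x', x') / (1 + <grad u, grad u>) grad u,
   and along it y = f(x) satisfies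
     y'' = Hess f(x', x') / (1 + <grad u, grad u>) - C(x) y'^2.
   If the right-hand side of the equation of x is multiplied by any factor in
   [0, 1], then still y'' >= d |x'|^2 - K y'^2 with d, K > 0 depending only on
   the compact sublevel set of f containing x, so w = exp(K y) is convex.  Hence
   a solution joining two points stays in the smallest sublevel set containing
   them.  There w is bounded and w'' >= c |x'|^2, while |x''| <= B |x'|^2 makes
   1 / |x'| a B-Lipschitz function: a very large speed at one time would make
   the integral of t (1 - t) |x'|^2 too large.  So the speed is bounded
   independently of the factor.  Cutting the equation off outside these a priori
   bounds makes its right-hand side bounded and continuous; the boundary value
   problem for such an equation is solvable by Brouwer's fixed point theorem,
   applied to Euler's scheme, and a passage to the limit along an ultrafilter.
   Brouwer's theorem is obtained from Scarf's lemma on dominated sets. *)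

(** The metric of the graph is indefinite, so minimizing length or energy yields no geodesics;
    joining two points is treated as a boundary value problem with a priori bounds. The bounds must
    precede the cutoff, which depends on them: hence they are proved for the equation multiplied by
    a factor chi in [0, 1], with constants that do not involve the velocity cutoff. For such a
    factor the coefficient of Hess f(x', x') in y'' is 1 - chi + chi / (1 + <grad u, grad u>), a
    convex combination of two positive numbers. The other coefficient, chi s' s'' <grad f, grad f> /
    (1 + <grad u, grad u>), has no definite sign; its term is absorbed by the exponential, because
    exp(K y)'' = K exp(K y) (y'' + K y'^2). The Lorentzian condition passes from f to u since <grad
    u, grad u> = s'^2 <grad f, grad f> with s'^2 <= 1. *)

Import Order.TTheory GRing.Theory Num.Theory.
Import numFieldNormedType.Exports.

Local Open Scope ring_scope.

(** * Scarf's lemma *)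

Section Scarf.
Context {X I : finType} (r : I -> X -> nat) (e : I -> X) (t0 : X).
Hypothesis r_inj : forall i, injective (r i).
Hypothesis e_min : forall i y, (r i (e i) <= r i y)%N.
Hypothesis t0NE : forall i, t0 != e i.
Hypothesis e_max : forall i j y,
  i != j -> (forall k, y != e k) -> (r i y < r i (e j))%N.
Local Open Scope nat_scope.

(** No point lies strictly above the lowest point of [S] in every order at once. Such sets play the
    part of the simplices of a triangulation. *)
Definition dominated (S : {set X}) : bool :=
  [forall y, exists i, forall x in S, r i y <= r i x].

Lemma dominatedP (S : {set X}) :
  reflect (forall y, exists i, forall x, x \in S -> r i y <= r i x)
    (dominated S).
Proof.
apply: (iffP forallP) => [h y|h y].
  by have /existsP[i /forall_inP hi] := h y; exists i.
by have [i hi] := h y; apply/existsP; exists i; apply/forall_inP.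
Qed.

Lemma e_inj : injective e.
Proof.
move=> i j eij; case: (eqVneq i j) => // nij.
have := e_max _ _ _ nij t0NE.
by rewrite -eij ltnNge e_min.
Qed.

Lemma dominatedS (A B : {set X}) : A \subset B -> dominated B -> dominated A.
Proof.
move=> /fintype.subsetP AB /dominatedP h; apply/dominatedP => y.
by have [i hi] := h y; exists i => x /AB; exact: hi.
Qed.

Definition lowest (S : {set X}) (i : I) (a : X) : X := arg_min a (mem S) (r i).

Lemma lowestP (S : {set X}) i a : a \in S ->
  lowest S i a \in S /\ forall x, x \in S -> r i (lowest S i a) <= r i x.
Proof.
by move=> aS; rewrite /lowest; case: arg_minnP.
Qed.

Lemma lowest_eq (S : {set X}) i a y : a \in S -> y \in S ->
  (forall x, x \in S -> r i y <= r i x) -> lowest S i a = y.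
Proof.
move=> aS yS h; have [mS hm] := lowestP S i a aS.
by apply: (@r_inj i); apply/eqP; rewrite eqn_leq hm //= h.
Qed.

(** Domination is applied to a point of [S] itself: an order placing it below all of [S] has it as
    lowest point. *)
Lemma dominated_surj (S : {set X}) a : a \in S -> dominated S ->
  forall x, x \in S -> exists i, lowest S i a = x.
Proof.
move=> aS /dominatedP h x xS; have [i hi] := h x; exists i.
exact: lowest_eq.
Qed.

(* A dominated set of #|I| points is a room, one of #|I| - 1 points a door.
   In a door exactly one point is lowest for two orders [i1], [i2]: a room over
   the door arises by replacing that point in one of the two orders. *)
Lemma door_twins (S : {set X}) a : a \in S -> dominated S -> #|S|.+1 = #|I| ->
  exists i1 i2, [/\ i1 != i2, lowest S i1 a = lowest S i2 a &
    forall i j, i != j -> lowest S i a = lowest S j a ->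
      (i = i1 /\ j = i2) \/ (i = i2 /\ j = i1)].
Proof.
move=> aS dS cS.
pose m i := lowest S i a.
have mS i : m i \in S by have [] := lowestP S i a aS.
have im : m @: [set: I] = S.
  apply/finset.setP => x; apply/imsetP/idP => [[i _ ->]//|xS].
  by have [i mi] := dominated_surj S a aS dS x xS; exists i; rewrite ?inE.
have ninj : ~~ injectiveb m.
  apply/negP => /injectiveP minj.
  by have := card_imset [set: I] minj; rewrite im cardsT -cS; lia.
have [i1 [i2 [n12 m12]]] : exists i1 i2, i1 != i2 /\ m i1 = m i2.
  by move/injectivePn: ninj => [i1 [i2 n12 m12]]; exists i1, i2.
exists i1, i2; split=> // i j nij mij.
(* Dropping one index of a coincidence keeps the image, and #|I| - 1 indices mapped onto #|I| - 1
   points are mapped injectively. *)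
have inj1 (k : I) : (exists2 l, l != k & m l = m k) -> {in [set~ k] &, injective m}.
  move=> [l lk ml]; apply/imset_injP/eqP.
  have -> : m @: [set~ k] = S.
    apply/eqP; rewrite finset.eqEsubset; apply/andP; split.
      by apply/fintype.subsetP => _ /imsetP[x _ ->].
    rewrite -im; apply/fintype.subsetP => _ /imsetP[x _ ->].
    case: (eqVneq x k) => [->|xk].
      by rewrite -ml; apply: imset_f; rewrite !inE.
    by apply: imset_f; rewrite !inE.
  by rewrite cardsC1 -cS.
have h1 : {in [set~ i1] &, injective m}.
  by apply: inj1; exists i2; rewrite 1?eq_sym.
have h2 : {in [set~ i2] &, injective m} by apply: inj1; exists i1.
have aux x y z : x != z -> y != z -> x != y ->
   {in [set~ z] &, injective m} -> m x = m y -> False.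
  move=> xz yz xy inj mm; have := inj x y; rewrite !inE => /(_ xz yz mm) exy.
  by rewrite exy eqxx in xy.
case: (eqVneq i i1) => [ii1|ni1]; case: (eqVneq j i2) => [ji2|nj2].
- by left.
- case: (eqVneq i i2) => [ii2|ni2].
    by rewrite -ii1 ii2 eqxx in n12.
  by case: (aux i j i2).
- case: (eqVneq j i1) => [ji1|nj1]; last by case: (aux i j i1).
  by rewrite ji1 in ji2; rewrite ji2 eqxx in n12.
- case: (eqVneq j i1) => [ji1|nj1].
    case: (eqVneq i i2) => [ii2|ni2]; first by right.
    by case: (aux i j i2).
  by case: (aux i j i1).
Qed.

(** In a room each point is lowest for exactly one order. If [y] is lowest for [k], the other orders
    keep their lowest points in [S], which are then distinct; so [k] is one of the twins. Domination
    of the room makes [y] the highest for [k] among the points above the other minima. *)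
Lemma room_pivot (S : {set X}) a i1 i2 y : a \in S -> dominated S ->
    #|S|.+1 = #|I| ->
    i1 != i2 -> lowest S i1 a = lowest S i2 a ->
    (forall i j, i != j -> lowest S i a = lowest S j a ->
      (i = i1 /\ j = i2) \/ (i = i2 /\ j = i1)) ->
  y \notin S -> dominated (y |: S) ->
  exists2 k, k \in [set i1; i2] &
    [/\ r k y < r k (lowest S k a),
        forall i, i != k -> r i (lowest S i a) < r i y &
        forall z, (forall i, i != k -> r i (lowest S i a) < r i z) ->
          r k z <= r k y].
Proof.
move=> aS dS cS n12 m12 tw yS dR.
pose m i := lowest S i a.
have [mS mlow] : (forall i, m i \in S) /\ (forall i x, x \in S -> r i (m i) <= r i x).
  by split=> i; have [] := lowestP S i a aS.
have yR : y \in y |: S by rewrite !inE eqxx.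
have surj := dominated_surj _ _ yR dR.
have [k ky] := surj y yR.
have klow x : x \in S -> r k y <= r k x.
  have [_] := lowestP (y |: S) k y yR; rewrite ky => h xS; apply: h.
  by rewrite !inE xS orbT.
have klt : r k y < r k (m k).
  rewrite ltn_neqAle klow // andbT; apply/eqP => /r_inj ym.
  by rewrite ym mS in yS.
have cR : #|y |: S| = #|I| by rewrite cardsU1 yS.
pose m' i := lowest (y |: S) i y.
have im' : m' @: [set: I] = y |: S.
  apply/finset.setP => x; apply/imsetP/idP => [[i _ ->]|xS].
    by have [] := lowestP (y |: S) i y yR.
  by have [i mi] := surj x xS; exists i; rewrite ?inE.
have m'inj : injective m'.
  have : {in [set: I] &, injective m'} by apply/imset_injP/eqP; rewrite im' cR cardsT.
  by move=> h i j; apply: h; rewrite inE.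
have others i : i != k -> r i (m i) < r i y.
  move=> ik; rewrite ltnNge; apply/negP => ley.
  have : m' i = m' k.
    rewrite {2}/m' ky; apply: lowest_eq => // x; rewrite !inE => /orP[/eqP->//|xS].
    by apply: (leq_trans ley); exact: mlow.
  by move/m'inj => eik; rewrite eik eqxx in ik.
have m'E i : i != k -> m' i = m i.
  move=> ik; apply: lowest_eq => //; first by rewrite !inE mS orbT.
  move=> x; rewrite !inE => /orP[/eqP->|xS]; last exact: mlow.
  by rewrite ltnW // others.
exists k.
  rewrite !inE; apply/negPn/negP; rewrite negb_or => /andP[k1 k2].
  have : m' i1 = m' i2 by rewrite !m'E // eq_sym.
  by move/m'inj => e12; rewrite e12 eqxx in n12.
split=> // z hz.
have /dominatedP/(_ z)[i hi] := dR.
case: (eqVneq i k) => [<-|ik]; first exact: hi.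
have := hz i ik; rewrite ltnNge hi //.
by rewrite !inE mS orbT.
Qed.

(** Converse of [room_pivot]. A point above all minima for [i != k] is dominated in the order [k],
    by maximality of [y]; any other point fails to exceed one of these minima and is dominated
    there. *)
Lemma pivot_room (S : {set X}) a i1 i2 k y : a \in S -> dominated S ->
    i1 != i2 -> lowest S i1 a = lowest S i2 a -> k \in [set i1; i2] ->
    (forall i, i != k -> r i (lowest S i a) < r i y) ->
    (forall z, (forall i, i != k -> r i (lowest S i a) < r i z) ->
          r k z <= r k y) ->
  [/\ y \notin S, dominated (y |: S) & r k y < r k (lowest S k a)].
Proof.
move=> aS dS n12 m12 kk hy maxy.
pose m i := lowest S i a.
have [mS mlow] : (forall i, m i \in S) /\ (forall i x, x \in S -> r i (m i) <= r i x).
  by split=> i; have [] := lowestP S i a aS.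
have [l lk ml] : exists2 l, l != k & m l = m k.
  move: kk; rewrite !inE => /orP[]/eqP->; [exists i2|exists i1]=> //.
  by rewrite eq_sym.
have yk : r k y < r k (m k).
  have /dominatedP/(_ y)[i hi] := dS.
  case: (eqVneq i k) => [ik|ik]; last first.
    by have := hy i ik; rewrite ltnNge hi ?mS.
  rewrite -ik ltn_neqAle hi // andbT; apply/eqP => /r_inj ym.
  by have := hy l lk; rewrite -/(m l) ml ym ik ltnn.
split=> //.
  apply/negP => yS; have := mlow k y yS.
  by rewrite leqNgt yk.
apply/dominatedP => z.
case: (boolP [forall i, (i != k) ==> (r i (m i) < r i z)]) => [/forallP h|].
  exists k => x; rewrite !inE => /orP[/eqP->|xS].
    by apply: maxy => i ik; have := h i; rewrite ik.
  apply: leq_trans (mlow k x xS); apply: leq_trans (ltnW yk).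
  by apply: maxy => i ik; have := h i; rewrite ik.
rewrite negb_forall => /existsP[i]; rewrite negb_imply -leqNgt => /andP[ik hi].
exists i => x; rewrite !inE => /orP[/eqP->|xS].
  by apply: (leq_trans hi); rewrite ltnW // hy.
by apply: (leq_trans hi); apply: mlow.
Qed.

Definition rooms_over (S : {set X}) : {set {set X}} :=
  [set Q : {set X} | [&& dominated Q, #|Q| == #|I| & S \subset Q]].

(** A pivot in the order [k] has a candidate. This fails for one twin of the outer door, which
    therefore bounds only one room. *)
Definition raisable (S : {set X}) a k : bool :=
  [exists y, forall i, (i != k) ==> (r i (lowest S i a) < r i y)].

(** Each raisable twin [k] gives one room, by adding its highest candidate. Different twins give
    different rooms: in the order [k] the point added for [k] is below the minimum of [S], the point
    added for the other twin above it. *)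
Lemma card_rooms_over (S : {set X}) a i1 i2 : a \in S -> dominated S ->
    #|S|.+1 = #|I| -> i1 != i2 -> lowest S i1 a = lowest S i2 a ->
    (forall i j, i != j -> lowest S i a = lowest S j a ->
      (i = i1 /\ j = i2) \/ (i = i2 /\ j = i1)) ->
  #|rooms_over S| = #|[set k in [set i1; i2] | raisable S a k]|.
Proof.
move=> aS dS cS n12 m12 tw.
pose above k := [pred y | [forall i, (i != k) ==> (r i (lowest S i a) < r i y)]].
have aboveP k y : reflect (forall i, i != k -> r i (lowest S i a) < r i y) (y \in above k).
  apply: (iffP forallP) => h i; first by move=> ik; have := h i; rewrite ik.
  by apply/implyP; exact: h.
pose w k := if [pick y in above k] is Some y0 then arg_max y0 (mem (above k)) (r k) else a.
have wP k : raisable S a k -> w k \in above k /\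
    forall z, z \in above k -> r k z <= r k (w k).
  move=> /existsP[y ay]; rewrite /w; case: pickP => [y0 ay0|/(_ y)]; last first.
    by rewrite inE ay.
  by case: arg_maxnP => // z az hz; split.
have wroom k : k \in [set i1; i2] -> raisable S a k ->
    [/\ w k \notin S, dominated (w k |: S) & r k (w k) < r k (lowest S k a)].
  move=> k12 /wP[wa wmax]; apply: (pivot_room S a i1 i2 k) => //.
    exact/aboveP.
  by move=> z hz; apply: wmax; exact/aboveP.
have <- : [set w k |: S | k in [set k in [set i1; i2] | raisable S a k]] = rooms_over S.
  apply/finset.setP => Q; rewrite !inE; apply/imsetP/idP => [[k]|].
    rewrite inE => /andP[k12 rk] ->; have [wS wd _] := wroom k k12 rk.
    by rewrite wd cardsU1 wS add1n cS eqxx finset.subsetUr.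
  move=> /and3P[dQ /eqP cQ SQ].
  have [y yQ yS] : exists2 y, y \in Q & y \notin S.
    apply/fintype.subsetPn; apply/negP => QS; have := subset_leq_card QS.
    by rewrite cQ -cS ltnn.
  have QE : Q = y |: S.
    apply/esym/eqP; rewrite eqEcard cardsU1 yS add1n cQ -cS leqnn andbT.
    by rewrite finset.subUset finset.sub1set yQ.
  rewrite QE in dQ.
  have [k k12 [yk yab ymax]] := room_pivot S a i1 i2 y aS dS cS n12 m12 tw yS dQ.
  have rk : raisable S a k by apply/existsP; exists y; exact/aboveP.
  exists k; first by rewrite inE k12.
  have [/aboveP wa wmax] := wP k rk.
  suff -> : w k = y by [].
  apply: (@r_inj k); apply/eqP; rewrite eqn_leq ymax //= wmax //.
  exact/aboveP.
rewrite card_in_imset // => k l; rewrite !inE => /andP[kk rk] /andP[ll rl] eQ.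
have [wS _ wlt] := wroom k ltac:(by rewrite !inE) rk.
have [wS' _ wlt'] := wroom l ltac:(by rewrite !inE) rl.
have ew : w k = w l.
  have : w k \in w l |: S by rewrite -eQ !inE eqxx.
  by rewrite !inE (negPf wS) orbF => /eqP.
case: (eqVneq k l) => // kl.
have [/aboveP wa _] := wP l rl.
by have := wa k kl; rewrite -ew ltnNge ltnW.
Qed.

Hypothesis I2 : 1 < #|I|.

(** * Parity of incidences between doors and rooms *)

Section Colored.
Context (c : X -> I) (i0 : I).
Hypothesis ce : forall i, c (e i) = i.

Definition doors : {set {set X}} :=
  [set S : {set X} | [&& dominated S, #|S|.+1 == #|I| & c @: S == [set~ i0]]].

Definition rooms : {set {set X}} :=
  [set Q : {set X} | dominated Q & #|Q| == #|I|].

Definition outer_door : {set X} := e @: [set~ i0].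

Lemma outer_door_in : outer_door \in doors.
Proof.
rewrite inE; apply/and3P; split.
- apply/dominatedP => y; case: (pickP (fun k => y == e k)) => [k /eqP->|h].
    by exists k => x _; exact: e_min.
  exists i0 => x /imsetP[j]; rewrite !inE => j0 ->.
  by rewrite ltnW // e_max 1?eq_sym // => k; rewrite h.
- rewrite card_imset; last exact: e_inj.
  by rewrite cardsC1 prednK // (ltn_trans _ I2).
- apply/eqP; rewrite -imset_comp -[RHS]imset_id.
  by apply: eq_imset => k /=.
Qed.

(** An inner door contains a point [x] that is no [e i]; since [e k] exceeds [x] in every order but
    [k], both twins are raisable. In the outer door the lowest point for [i != i0] is [e i], so [i0]
    is a twin, and it alone is raisable, with candidate [t0]. *)
Lemma odd_rooms_over (S : {set X}) : S \in doors ->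
  odd #|rooms_over S| = (S == outer_door).
Proof.
rewrite inE => /and3P[dS /eqP cS /eqP iS].
have [a aS] : exists a, a \in S.
  by apply/card_gt0P; move: I2; rewrite -cS.
have [i1 [i2 [n12 m12 tw]]] := door_twins S a aS dS cS.
rewrite (card_rooms_over S a i1 i2) //.
have [mS mlow] : (forall i, lowest S i a \in S) /\
    (forall i x, x \in S -> r i (lowest S i a) <= r i x).
  by split=> i; have [] := lowestP S i a aS.
case: (eqVneq S outer_door) => [So|So].
  have mE i : i != i0 -> lowest S i a = e i.
    move=> ii0; apply: lowest_eq => //.
    by rewrite So; apply: imset_f; rewrite !inE ii0.
  suff -> : [set k in [set i1; i2] | raisable S a k] = [set i0].
    by rewrite cards1.
  have i0in : i0 \in [set i1; i2].
    rewrite !inE; apply/negPn/negP; rewrite negb_or => /andP[n1 n2].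
    have : e i1 = e i2 by rewrite -!mE // eq_sym.
    by move/e_inj => e12; rewrite e12 eqxx in n12.
  apply/finset.setP => k; rewrite [RHS]inE inE; apply/andP/eqP => [[k12]|->].
    move=> /existsP[z /forallP hz]; apply/eqP/negPn/negP => ki0.
    have z0 : r i0 (lowest S i0 a) < r i0 z by have := hz i0; rewrite eq_sym ki0.
    have m0 : lowest S i0 a = e k.
      rewrite -(mE k ki0); move: i0in k12 m12; rewrite !inE.
      by move=> /orP[]/eqP<- /orP[]/eqP E; rewrite -E ?eqxx // in ki0 *.
    case: (pickP (fun j => z == e j)) => [j /eqP zj|h].
      case: (eqVneq j k) => [jk|jk].
        by move: z0; rewrite m0 zj jk ltnn.
      by have := hz j; rewrite jk zj ltnNge e_min.
    have : r i0 z < r i0 (e k).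
      by apply: e_max => [|l]; [rewrite eq_sym|rewrite h].
    by rewrite ltnNge ltnW // -m0.
  split=> //; apply/existsP; exists t0; apply/forallP => i; apply/implyP => ii0.
  rewrite mE // ltn_neqAle e_min andbT; apply/eqP => /r_inj E.
  by have := t0NE i; rewrite E eqxx.
have [x xS xe] : exists2 x, x \in S & forall k, x != e k.
  case: (boolP [exists x in S, [forall k, x != e k]]).
    by move=> /existsP[x /andP[xS /forallP xe]]; exists x.
  rewrite negb_exists => /forallP h.
  have hS x : x \in S -> x = e (c x).
    move=> xS; have := h x; rewrite xS /= negb_forall => /existsP[k].
    by rewrite negbK => /eqP ->; rewrite ce.
  case/eqP: So; rewrite /outer_door -iS -imset_comp -[LHS]imset_id.
  by apply: eq_in_imset => y yS /=; rewrite -hS.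
suff -> : [set k in [set i1; i2] | raisable S a k] = [set i1; i2].
  by rewrite cards2 n12.
apply/finset.setP => k; rewrite inE andb_idr // => _.
apply/existsP; exists (e k); apply/forallP => i; apply/implyP => ik.
by apply: leq_ltn_trans (mlow i x xS) _; exact: e_max.
Qed.

(** If such a room has a door at all, exactly two of its points share a colour, and deleting either
    of them gives its two doors. *)
Lemma even_doors_below (Q : {set X}) : Q \in rooms -> c @: Q != [set: I]%SET ->
  ~~ odd #|[set S in doors | Q \in rooms_over S]|.
Proof.
rewrite inE => /andP[dQ /eqP cQ] ncQ.
have belowP S : reflect (exists x, [/\ x \in Q, S = Q :\ x & c @: (Q :\ x) = [set~ i0]])
    (S \in [set S in doors | Q \in rooms_over S]).
  rewrite !inE dQ cQ eqxx /=; apply: (iffP idP).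
    move=> /andP[/and3P[dS /eqP cS /eqP iS] SQ].
    have [x xQ xS] : exists2 x, x \in Q & x \notin S.
      apply/fintype.subsetPn; apply/negP => QS; have := subset_leq_card QS.
      by rewrite cQ -cS ltnn.
    have SE : S = Q :\ x.
      apply/eqP; rewrite eqEcard finset.subsetD1 SQ xS /=.
      by have := cardsD1 x Q; rewrite xQ cQ -cS add1n => -[->].
    by exists x; rewrite -SE.
  move=> [x [xQ -> iS]]; rewrite iS eqxx andbT subD1set andbT.
  rewrite (dominatedS _ Q) ?subD1set //=.
  by have := cardsD1 x Q; rewrite xQ cQ add1n => ->.
case: (set_0Vmem [set S in doors | Q \in rooms_over S]) => [->|[S0]].
  by rewrite cards0.
move=> /belowP[x0 [x0Q _ i0Q]].
have cx0 : c x0 != i0.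
  apply: contra ncQ => /eqP cx0; rewrite -(finset.setD1K x0Q) imsetU1 i0Q cx0.
  by rewrite finset.setUCr.
have inj0 : {in Q :\ x0 &, injective c}.
  apply/imset_injP; rewrite i0Q cardsC1 -cQ.
  by have := cardsD1 x0 Q; rewrite x0Q add1n => ->.
have [x1 x1Q cx1] : exists2 x1, x1 \in Q :\ x0 & c x0 = c x1.
  by apply/imsetP; rewrite i0Q !inE.
have [x10 x1Q'] : x1 != x0 /\ x1 \in Q by move: x1Q; rewrite !inE => /andP[].
suff -> : [set S in doors | Q \in rooms_over S] = [set Q :\ x0; Q :\ x1].
  rewrite cards2; suff -> : Q :\ x0 != Q :\ x1 by [].
  by apply/eqP => /finset.setP/(_ x1); rewrite !inE x1Q' x10 eqxx.
have swap : c @: (Q :\ x1) = [set~ i0].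
  rewrite -i0Q; apply/finset.setP => k.
  apply/imsetP/imsetP => -[x]; rewrite !inE => /andP[xx xQ] ->.
    case: (eqVneq x x0) => [->|xx0]; first by exists x1.
    by exists x; rewrite ?inE ?xx0.
  case: (eqVneq x x1) => [->|xx1]; first by exists x0; rewrite ?inE 1?eq_sym ?x10.
  by exists x; rewrite ?inE ?xx1.
apply/finset.setP => S; rewrite [RHS]inE !finset.in_set1; apply/belowP/orP.
  move=> [x [xQ -> iQ]].
  case: (eqVneq x x0) => [->|xx0]; first by left.
  case: (eqVneq x x1) => [->|xx1]; first by right.
  have : c x \in c @: (Q :\ x).
    by rewrite iQ -i0Q; apply: imset_f; rewrite !inE xx0.
  move=> /imsetP[y]; rewrite !inE => /andP[yx yQ] cxy.
  have xin : x \in Q :\ x0 by rewrite !inE xx0.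
  case: (eqVneq y x0) => [y0|yx0].
    have := inj0 x x1 xin x1Q; rewrite cxy y0 => /(_ cx1) E.
    by rewrite E eqxx in xx1.
  have := inj0 x y xin; rewrite !inE yx0 yQ => /(_ isT cxy) E.
  by rewrite E eqxx in yx.
by move=> [] /eqP ->; [exists x0|exists x1].
Qed.

End Colored.

(** Incidences are counted twice modulo 2: if no room had all colours, the sum over rooms would be
    even, but the sum over doors is odd because of the outer door. *)
Lemma scarf (c : X -> I) : (forall i, c (e i) = i) ->
  exists2 S : {set X}, dominated S & c @: S = [set: I]%SET.
Proof.
move=> ce; have [i0 _] : exists i0 : I, true.
  by have /card_gt0P[i _] : 0 < #|I| by apply: ltn_trans I2.
apply: contrapT => none.
have evenR : ~~ odd (\sum_(Q in rooms) #|[set S in doors c i0 | Q \in rooms_over S]|).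
  elim/big_ind: _ => // [x y|Q Qr]; first by rewrite oddD => /negPf-> /negPf->.
  apply: even_doors_below => //; apply/eqP => cQ; apply: none; exists Q => //.
  by move: Qr; rewrite inE => /andP[].
suff : odd (\sum_(Q in rooms) #|[set S in doors c i0 | Q \in rooms_over S]|).
  by rewrite (negPf evenR).
have -> : \sum_(Q in rooms) #|[set S in doors c i0 | Q \in rooms_over S]| =
    \sum_(S in doors c i0) #|rooms_over S|.
  under eq_bigr do rewrite -sum1_card.
  under [RHS]eq_bigr do rewrite -sum1_card.
  rewrite (exchange_big_dep (fun S => S \in doors c i0)) /=; last first.
    by move=> Q S _; rewrite inE => /andP[].
  apply: eq_bigr => S Sd; apply: eq_bigl => Q.
  rewrite !inE; move: Sd; rewrite inE => -> /=.
  by case: (dominated Q); case: (#|Q| == #|I|).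
rewrite (bigD1 (outer_door i0)) ?outer_door_in //= oddD.
rewrite (odd_rooms_over c i0 ce) ?outer_door_in // eqxx /=.
elim/big_ind: _ => // [x y|S /andP[Sd So]]; first by rewrite oddD => /negPf-> /negPf->.
by rewrite (odd_rooms_over c i0 ce) ?(negPf So).
Qed.

End Scarf.

(** * Brouwer's fixed point theorem *)

Section Grid.
Context {I : finType} (N : nat).
Hypothesis I2 : (1 < #|I|)%N.
Local Open Scope nat_scope.

Definition grid : finType := {t : {ffun I -> 'I_N.+1} | \sum_i (t i : nat) == N}.
Definition gval (t : grid) (i : I) : nat := val t i.

Lemma gvalN (t : grid) i : gval t i < N.+1. Proof. exact: ltn_ord. Qed.

Lemma gval_sum (t : grid) : \sum_i gval t i = N.
Proof. exact/eqP/(valP t). Qed.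

Lemma gval_ex (y : I -> nat) : \sum_i y i = N -> exists t, forall i, gval t i = y i.
Proof.
move=> sy.
have yN i : y i < N.+1 by rewrite ltnS -sy (bigD1 i) //= leq_addr.
pose t := [ffun i => Ordinal (yN i)].
have st : \sum_i (t i : nat) == N.
  by apply/eqP; rewrite -[RHS]sy; apply: eq_bigr => i _; rewrite ffunE.
by exists (exist _ t st : grid) => i; rewrite /gval /= ffunE.
Qed.

Definition grid_size : nat := #|{: grid}|.

Lemma enum_rank_lt (t : grid) : (enum_rank t : nat) < grid_size.
Proof. exact: ltn_ord. Qed.

(** Grid points are compared by their coordinate [i], with ties broken by [enum_rank]. The points
    [inr j] are artificial vertices: [inr i] gets the rank 0 kept free by the successor, the others
    lie above the whole grid. *)
Definition grank (i : I) (x : grid + I) : nat :=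
  match x with
  | inl t => (gval t i * grid_size + enum_rank t).+1
  | inr j => if j == i then 0 else (N.+1 * grid_size + enum_rank j).+1
  end.

Lemma grank_lt i t j : j != i -> grank i (inl t) < grank i (inr j).
Proof.
move=> /negPf /= ->; rewrite ltnS.
have := enum_rank_lt t; move: (enum_rank t : nat) => k kG.
have : (gval t i).+1 * grid_size <= N.+1 * grid_size by rewrite leq_mul2r gvalN orbT.
by rewrite mulSn; lia.
Qed.

Lemma grank_le i t u : grank i (inl t) <= grank i (inl u) -> gval t i <= gval u i.
Proof.
rewrite /= ltnS; have := enum_rank_lt t; have := enum_rank_lt u.
move: (enum_rank t : nat) (enum_rank u : nat) => k l lG kG le.
rewrite leqNgt; apply/negP => lt.
have : (gval u i).+1 * grid_size <= gval t i * grid_size by rewrite leq_mul2r lt orbT.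
by rewrite mulSn; lia.
Qed.

Lemma grank_inj i : injective (grank i).
Proof.
move=> [t|j] [u|k].
- move=> tu; have : gval t i = gval u i.
    by apply/eqP; rewrite eqn_leq !grank_le // tu.
  move: tu => /= [] + E; rewrite E => /addnI /ord_inj /enum_rank_inj -> //.
- case: (eqVneq k i) => [->|ki] E; first by move: E; rewrite /= eqxx.
  by have := grank_lt i t k ki; rewrite E ltnn.
- case: (eqVneq j i) => [->|ki] E; first by move: E; rewrite /= eqxx.
  by have := grank_lt i u j ki; rewrite E ltnn.
- rewrite /=; case: (eqVneq j i) => [->|ji]; case: (eqVneq k i) => [->|ki] //.
  by move=> [] /addnI /ord_inj /enum_rank_inj ->.
Qed.

(** The grid points of a dominated set are close together: the minima of their coordinates in [C]
    have a sum near [N], so little is left for deviations and for the coordinates outside [C]. If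
    the artificial vertex [i] is in the set, no grid point of colour [i] is guaranteed; then [a]
    serves, its coordinate [i] being small. *)
Lemma grid_colorful (c : grid -> I) : exists a (x : I -> grid), forall i,
  (forall j, gval (x i) j <= gval a j + #|I| /\ gval a j <= gval (x i) j + #|I|)
  /\ (c (x i) = i \/ (x i = a /\ gval a i <= #|I|)).
Proof.
have [i0 _] : exists i0 : I, true.
  by have /card_gt0P[i _] : 0 < #|I| by apply: ltn_trans I2.
have [t0 _] : exists t0 : grid, true.
  have [|t _] := gval_ex (fun i => if i == i0 then N else 0); last by exists t.
  by rewrite -big_mkcond big_pred1_eq.
pose c' (x : grid + I) := match x with inl t => c t | inr i => i end.
have [S /dominatedP dS cS] :
    exists2 S : {set grid + I}, dominated grank S & c' @: S = [set: I]%SET.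
  apply: (@scarf _ _ grank inr (inl t0)) => //.
  - exact: grank_inj.
  - by move=> i y /=; rewrite eqxx.
  - move=> i j [t|k] ij h; last by have := h k; rewrite eqxx.
    by apply: grank_lt; rewrite eq_sym.
pose A := [set t | inl t \in S]; pose C := [set i | inr i \notin S].
have col i : exists2 x, x \in S & c' x = i.
  have : i \in c' @: S by rewrite cS inE.
  by move=> /imsetP[x xS ->]; exists x.
have domA y : exists2 i, i \in C & forall t, t \in A -> gval y i <= gval t i.
  have [i hi] := dS (inl y); exists i.
    by rewrite inE; apply/negP => /hi /=; rewrite eqxx.
  by move=> t; rewrite inE => /hi; exact: grank_le.
have colA i : i \in C -> exists2 t, t \in A & c t = i.
  rewrite inE => iS; have [[t|j] xS /= ct] := col i.
    by exists t; rewrite ?inE.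
  by rewrite -ct xS in iS.
have [i1 i1C _] := domA t0.
have [a aA _] := colA i1 i1C.
pose m i := gval (arg_min a (mem A) (gval^~ i)) i.
have mP i : (exists2 t, t \in A & gval t i = m i) /\ forall t, t \in A -> m i <= gval t i.
  by rewrite /m; case: arg_minnP => // t tA ht; split; [exists t|].
(* Otherwise some grid point exceeds all these minima, against domination; what is missing to the
   sum [N] is put into the coordinate [i1]. *)
have mbig : N < \sum_(i in C) (m i).+1.
  rewrite ltnNge; apply/negP => le.
  have le1 : \sum_(i in C | i != i1) (m i).+1 + (m i1).+1 <= N.
    by move: le; rewrite (bigD1 i1) //= addnC.
  pose y i := if i == i1 then N - \sum_(i in C | i != i1) (m i).+1
              else if i \in C then (m i).+1 else 0.
  have [|t ht] := gval_ex y.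
    rewrite (bigD1 i1) //= {1}/y eqxx.
    suff -> : \sum_(i | i != i1) y i = \sum_(i in C | i != i1) (m i).+1 by lia.
    rewrite [RHS]big_mkcondl; apply: eq_bigr => i /negPf ii1.
    by rewrite /y ii1.
  have [i iC hi] := domA t; have [[u uA um] _] := mP i.
  have := hi u uA; rewrite ht um /y; case: eqP => [->|_]; last by rewrite iC ltnn.
  by lia.
have cC : #|C| <= #|I| by exact: max_card.
have msum : N + 1 <= \sum_(i in C) m i + #|I|.
  have : \sum_(i in C) (m i).+1 = \sum_(i in C) m i + #|C|.
    rewrite -sum1_card -big_split /=; by apply: eq_bigr => i _; rewrite addn1.
  lia.
have bnd t : t \in A -> \sum_(i in C) (gval t i - m i) + \sum_(i | i \notin C) gval t i <= #|I|.
  move=> tA.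
  have : \sum_i gval t i =
    \sum_(i in C) (gval t i - m i) + \sum_(i in C) m i + \sum_(i | i \notin C) gval t i.
    rewrite (bigID (mem C)) /=; congr (_ + _); rewrite -big_split /=.
    by apply: eq_bigr => i _; rewrite subnK //; case: (mP i) => _; apply.
  rewrite gval_sum; lia.
have bC t i : t \in A -> i \in C -> m i <= gval t i <= m i + #|I|.
  move=> tA iC; have := bnd t tA; rewrite (bigD1 i) //= => b.
  by have [_ /(_ t tA) mt] := mP i; rewrite mt /=; lia.
have bnC t i : t \in A -> i \notin C -> gval t i <= #|I|.
  by move=> tA iC; have := bnd t tA; rewrite (bigD1 i iC) /=; lia.
have dist t : t \in A -> forall j, gval t j <= gval a j + #|I| /\ gval a j <= gval t j + #|I|.
  move=> tA j; case: (boolP (j \in C)) => jC.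
    by have := bC t j tA jC; have := bC a j aA jC; lia.
  by have := bnC t j tA jC; have := bnC a j aA jC; lia.
have ex i : exists t, (forall j, gval t j <= gval a j + #|I| /\ gval a j <= gval t j + #|I|)
  /\ (c t = i \/ (t = a /\ gval a i <= #|I|)).
  case: (boolP (i \in C)) => iC.
    by have [t tA ct] := colA i iC; exists t; split; [exact: dist|left].
  by exists a; split; [exact: dist|right; split=> //; exact: bnC].
by have [x hx] := choice ex; exists a, x.
Qed.

End Grid.

Local Open Scope classical_set_scope.

Section Brouwer.
Context {R : realType}.

Definition simplex (I : finType) (x : I -> R) : Prop :=
  (forall i, 0 <= x i) /\ \sum_i x i = 1.

(** A grid point is coloured by a coordinate that [h] does not decrease; one exists because both
    coordinate sums are 1. In the second alternative of [grid_colorful] the left-hand side of the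
    last inequality is at most 0. *)
Lemma simplex_approx (I : finType) (N : nat) (h : (I -> R) -> I -> R) :
  (1 < #|I|)%N -> (0 < N)%N -> (forall x, simplex I x -> simplex I (h x)) ->
  exists a (x : I -> I -> R), simplex I a /\ forall i,
    [/\ simplex I (x i), forall j, `|x i j - a j| <= #|I|%:R / N%:R &
        x i i - #|I|%:R / N%:R <= h (x i) i].
Proof.
move=> I2 N0 hs.
have N0' : 0 < N%:R :> R by rewrite ltr0n.
pose pt (t : @grid I N) (i : I) : R := (gval N t i)%:R / N%:R.
have spt t : simplex I (pt t).
  split=> [i|]; first by rewrite divr_ge0.
  by rewrite -mulr_suml -natr_sum gval_sum divff ?gt_eqF.
have ex t : exists i, pt t i <= h (pt t) i.
  apply: contrapT => /forallNP lt.
  have [_ s1] := spt t; have [_ s2] := hs _ (spt t).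
  have [i0 _] : exists i0 : I, true.
    by have /card_gt0P[i _] : (0 < #|I|)%N by apply: ltn_trans I2.
  have : \sum_i h (pt t) i < \sum_i pt t i.
    apply: ltr_sum => [|i _]; last by rewrite ltNge; apply/negP.
    by apply/hasP; exists i0 => //; rewrite mem_index_enum.
  by rewrite s1 s2 ltxx.
have [c hc] := choice ex.
have [a [x hx]] := grid_colorful N I2 c.
have I0 : 0 <= #|I|%:R / N%:R :> R by rewrite divr_ge0.
exists (pt a), (fun i => pt (x i)); split=> // i; have [hd hcol] := hx i.
split=> //.
- move=> j; have [d1 d2] := hd j; rewrite /pt -mulrBl normrM normfV.
  rewrite [`|N%:R|]gtr0_norm // ler_pM2r ?invr_gt0 //.
  move: d1 d2; rewrite -!(ler_nat R) !natrD ler_norml => d1 d2; apply/andP; split; lra.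
- case: hcol => [cx|[-> ai]].
    by have := hc (x i); rewrite cx; lra.
  apply: (@le_trans _ _ 0); last by have [] := hs _ (spt a).
  by rewrite subr_le0 /pt ler_pM2r ?invr_gt0 // ler_nat.
Qed.

Lemma coord_le_norm n (v : 'rV[R]_n) i : `|v 0 i| <= `|v|.
Proof.
rewrite [leRHS]/Num.norm /= mx_normrE.
exact: (@le_bigmax _ _ _ 0 (fun ij : 'I_1 * 'I_n => `|v ij.1 ij.2|) (0, i)).
Qed.

Lemma rV_norm_le n (v : 'rV[R]_n) M : 0 <= M -> (forall i, `|v 0 i| <= M) -> `|v| <= M.
Proof.
move=> M0 h; rewrite [leLHS]/Num.norm /= mx_normrE; apply/bigmax_leP; split=> //.
by move=> [i j] _ /=; rewrite ord1.
Qed.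

(** An ultrafilter replaces the extraction of subsequences: along it all bounded sequences converge
    at once, in [bvp_solution] for every time. *)
Lemma ultra_nat : exists U : set_system nat, UltraFilter U /\ (\oo : set_system nat) `<=` U.
Proof. exact: ultraFilterLemma. Qed.

Lemma ultra_cvg n (U : set_system nat) (u : nat -> 'rV[R]_n) M :
  UltraFilter U -> (forall k, `|u k| <= M) -> exists l : 'rV[R]_n, u @ U --> l.
Proof.
move=> UU uM.
have cB : compact [set v : 'rV[R]_n | `|v| <= M].
  apply: bounded_closed_compact.
    by exists M; split=> [|x Mx v /= vM]; [exact: num_real|apply: ltW; exact: le_lt_trans Mx].
  exact: (@closed_comp _ _ (fun v : 'rV[R]_n => `|v|) [set x | x <= M] (fun v _ => @norm_continuous _ _ v) (@closed_le _ M)).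
have [l [_ hl]] : [set v : 'rV[R]_n | `|v| <= M] `&` cluster (u @ U) !=set0.
  apply: cB; change (U (u @^-1` [set v | `|v| <= M])).
  by apply: filterE => k; exact: uM.
exists l => A Al.
have [//|nA] := in_ultra_setVsetC (u @^-1` A) UU.
by have [x [/= nAx Ax]] := hl (~` A) A nA Al.
Qed.

(** The simplex on [option 'I_m] is mapped by [X] onto a simplex containing the cube of radius [L],
    with [None] as slack coordinate. In the limit no coordinate of [Psi l] is below that of [l], and
    the slack coordinate yields the reverse inequality between the sums. *)
Lemma brouwer m (Psi : 'rV[R]_m -> 'rV[R]_m) L : (0 < m)%N ->
  continuous Psi -> (forall x, `|Psi x| <= L) -> exists x, Psi x = x.
Proof.
move=> m0 cPsi bPsi.
wlog L0 : L bPsi / 0 < L.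
  move=> h; apply: (h (`|L| + 1)); last by rewrite ltr_wpDl.
  by move=> x; apply: le_trans (bPsi x) _; rewrite (le_trans (ler_norm L)) // lerDl.
(* The sum over [i] of [Psi x 0 i + L] never exceeds this, so the slack coordinate of [h] is
   nonnegative. *)
pose S : R := m%:R * (2 * L).
have mR : 0 < m%:R :> R by rewrite ltr0n.
have S0 : 0 < S by rewrite !mulr_gt0.
pose I : finType := option 'I_m.
have cI : #|I| = m.+1 by rewrite card_option card_ord.
pose X (y : I -> R) : 'rV[R]_m := \row_i (S * y (Some i) - L).
pose h (y : I -> R) (j : I) : R :=
  if j is Some i then (Psi (X y) 0 i + L) / S
  else 1 - \sum_(i < m) (Psi (X y) 0 i + L) / S.
have sumI (y : I -> R) : \sum_j y j = y None + \sum_i y (Some i).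
  rewrite (bigD1 None) //=; congr (_ + _).
  rewrite (reindex_omap Some id) /=; last by case.
  by apply: eq_bigl => i; rewrite eqxx.
have Psi_bnd x i : 0 <= Psi x 0 i + L <= 2 * L.
  have := le_trans (coord_le_norm _ (Psi x) i) (bPsi x).
  by rewrite ler_norml; lra.
have hs y : simplex I y -> simplex I (h y).
  move=> _; split; last by rewrite sumI /h subrK.
  move=> [i|] /=; first by rewrite divr_ge0 ?(ltW S0) //; case/andP: (Psi_bnd (X y) i).
  rewrite subr_ge0 -mulr_suml ler_pdivrMr // mul1r.
  apply: (@le_trans _ _ (\sum_(i < m) (2 * L))).
    by apply: ler_sum => i _; case/andP: (Psi_bnd (X y) i).
  by rewrite sumr_const card_ord -[leLHS]mulr_natl.
have ex N : exists ax : (I -> R) * (I -> I -> R), simplex I ax.1 /\ forall i,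
    [/\ simplex I (ax.2 i), forall j, `|ax.2 i j - ax.1 j| <= m.+1%:R / N.+1%:R &
        ax.2 i i - m.+1%:R / N.+1%:R <= h (ax.2 i) i].
  have [||a [x H]] := @simplex_approx I N.+1 h _ _ hs; rewrite ?cI //.
  by exists (a, x); rewrite -cI.
have [ax hax] := choice ex.
have [U [UU oU]] := ultra_nat.
have sX y : simplex I y -> `|X y| <= S + L.
  move=> [y0 y1]; apply: rV_norm_le; first by rewrite addr_ge0 ?ltW.
  move=> i; rewrite mxE; have yi1 : y (Some i) <= 1.
    by rewrite -y1 (bigD1 (Some i)) //= lerDl sumr_ge0.
  have Sy : 0 <= S * y (Some i) <= S.
    by rewrite mulr_ge0 ?(ltW S0) //= ger_pMr.
  rewrite ler_norml; lra.
have [l hl] : exists l : 'rV[R]_m, (fun N => X (ax N).1) @ U --> l.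
  by apply: (@ultra_cvg m U _ (S + L)) => k; apply: sX; case: (hax k).
have key e : 0 < e -> exists N, [/\ m.+1%:R / N.+1%:R < e,
    forall i, `|X ((ax N).2 i) - l| < e & forall i, `|Psi (X ((ax N).2 i)) - Psi l| < e].
  move=> e0.
  have /cvgrPdist_lt/(_ e e0)/nbhs_normP[d /= d0 hd] := cPsi l.
  pose e' := Num.min e d.
  have e'0 : 0 < e' by rewrite lt_min e0.
  have /cvgrPdist_lt/(_ (e' / 2)) := hl; rewrite divr_gt0 // => /(_ isT) h1.
  have h2 : \forall N \near U, m.+1%:R / N.+1%:R < Num.min e (e' / (2 * (S + 1))).
    apply: oU.
    have c0 : 0 < Num.min e (e' / (2 * (S + 1))).
      by rewrite lt_min e0 divr_gt0 // mulr_gt0 // ltr_wpDl // ltW.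
    have := near_infty_natSinv_lt (PosNum (divr_gt0 c0 (ltr0Sn R m))).
    apply: filterS => N /=; rewrite -(@ltr_pM2l _ m.+1%:R) ?ltr0n //.
    by rewrite mulrCA divff ?mulr1 // pnatr_eq0.
  have [N [/= n1 n2]] := filter_ex (filterI h1 h2).
  have Xl i : `|X ((ax N).2 i) - l| < e'.
    have -> : X ((ax N).2 i) - l = (X (ax N).1 - l) + (X ((ax N).2 i) - X (ax N).1).
      by rewrite [RHS]addrC addrA subrK.
    apply: le_lt_trans (ler_normD _ _) _; rewrite [ltRHS]splitr.
    apply: ltr_leD; first by rewrite distrC.
    have [_ /(_ i)[_ hd' _]] := hax N.
    apply: rV_norm_le => [|j]; first by rewrite divr_ge0 // ltW.
    rewrite !mxE opprB addrA subrK -mulrBr normrM (gtr0_norm S0).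
    apply: (@le_trans _ _ (S * (e' / (2 * (S + 1))))).
      rewrite ler_pM2l //  (le_trans (hd' _)) // ltW // (lt_le_trans n2) //.
      by rewrite ge_min lexx orbT.
    have S1 : 0 < S + 1 by rewrite ltr_wpDl // ltW.
    have -> : S * (e' / (2 * (S + 1))) = e' / 2 * (S / (S + 1)).
      by field; rewrite gt_eqF.
    by rewrite ger_pMr ?divr_gt0 // ler_pdivrMr // mul1r lerDl.
  exists N; split.
  - by apply: lt_le_trans n2 _; rewrite ge_min lexx.
  - by move=> i; apply: lt_le_trans (Xl i) _; rewrite ge_min lexx.
  - move=> i; rewrite distrC; apply: hd => /=; rewrite distrC.
    by apply: lt_le_trans (Xl i) _; rewrite ge_min lexx orbT.
have le1 i : l 0 i <= Psi l 0 i.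
  apply/ler_addgt0Pr => e e0.
  (* One [e1] for replacing [X y] by [l], one for [Psi (X y)] by [Psi l], and [S * e1] for the
     defect of the vertex in simplex coordinates. *)
  pose e1 := e / (2 + S).
  have [|N [n1 n2 n3]] := key e1; first by rewrite divr_gt0 // addr_gt0.
  have [_ /(_ (Some i))[_ _ /=]] := hax N.
  have := le_lt_trans (coord_le_norm _ _ i) (n2 (Some i)).
  have := le_lt_trans (coord_le_norm _ _ i) (n3 (Some i)).
  set y := (ax N).2 _; rewrite !mxE !ltr_norml => /andP[b1 b2] /andP[b3 b4] hh.
  have : y (Some i) - e1 <= (Psi (X y) 0 i + L) / S by rewrite (le_trans _ hh) // lerB // ltW.
  rewrite ler_pdivlMr // => b5.
  have -> : e = 2 * e1 + S * e1 by rewrite -mulrDl mulrC divfK // gt_eqF // addr_gt0.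
  lra.
have le2 : \sum_i Psi l 0 i <= \sum_i l 0 i.
  apply/ler_addgt0Pr => e e0.
  pose e1 := e / (2 * m%:R + S).
  have e10 : 0 < e1 by rewrite divr_gt0 // addr_gt0 // mulr_gt0.
  have -> : e = 2 * (m%:R * e1) + S * e1.
    by rewrite mulrA -mulrDl mulrC divfK // gt_eqF // addr_gt0 // mulr_gt0.
  clearbody e1; have [N [n1 n2 n3]] := key e1 e10.
  have [_ /(_ None)[[_ sy] _ /=]] := hax N.
  set y := (ax N).2 _ in sy *.
  have Psil : \sum_i Psi l 0 i <= \sum_i (Psi (X y) 0 i + e1).
    apply: ler_sum => i _.
    have := le_lt_trans (coord_le_norm _ _ i) (n3 None).
    by rewrite !mxE ltr_norml -/y; lra.
  have Xl : \sum_i (S * y (Some i) - L) <= \sum_i (l 0 i + e1).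
    apply: ler_sum => i _.
    have := le_lt_trans (coord_le_norm _ _ i) (n2 None).
    by rewrite !mxE ltr_norml -/y; lra.
  have sc (z : R) : \sum_(i < m) z = m%:R * z by rewrite sumr_const card_ord mulr_natl.
  move: Psil Xl; rewrite !big_split /= -mulr_sumr !sc.
  move: sy; rewrite sumI -mulr_suml big_split /= sc => sy b1 b2 hh.
  have : (\sum_(i < m) Psi (X y) 0 i + m%:R * L) / S <= 1 - y None + e1.
    move: hh n1; move: (m.+1%:R / N.+1%:R) => c; set A := _ / S; lra.
  rewrite ler_pdivrMr // (_ : 1 - y None = \sum_i y (Some i)); last by lra.
  move: b1 b2; set A := \sum_i Psi l 0 i; set D := \sum_i Psi (X y) 0 i.
  set E := \sum_i y _; set F := \sum_i l 0 i => b1 b2 b3.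
  lra.
exists l; apply/rowP => i; apply/eqP; rewrite eq_le le1 andbT.
rewrite leNgt; apply/negP => lt.
suff : \sum_i l 0 i < \sum_i Psi l 0 i by rewrite ltNge le2.
by rewrite [ltLHS](bigD1 i) // [ltRHS](bigD1 i) //= ltr_leD // ler_sum.
Qed.

End Brouwer.

(** * A second order boundary value problem *)

Section RowVectorTopology.
Context {R : realType}.

Lemma cvg_rV (T : Type) (F : set_system T) (FF : Filter F) n (f : T -> 'rV[R]_n)
    (l : 'rV[R]_n) :
  (forall i, (fun x => f x 0 i) @ F --> l 0 i) -> f @ F --> l.
Proof.
move=> h; apply/cvgrPdist_le => e e0.
have : \forall x \near F, forall i, `|l 0 i - f x 0 i| <= e.
  by apply: filter_forall => i; have /cvgrPdist_le/(_ e e0) := h i.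
apply: filterS => x hx; apply: rV_norm_le; first exact: ltW.
by move=> i; rewrite !mxE.
Qed.

Lemma continuous_rV (T : topologicalType) n (f : T -> 'rV[R]_n) :
  (forall i, continuous (fun x => f x 0 i)) -> continuous f.
Proof. by move=> h x; apply: cvg_rV => i; exact: h. Qed.

Lemma lsubmx_continuous m n : continuous (@lsubmx R 1 m n).
Proof.
apply: continuous_rV => i; under eq_fun do rewrite mxE.
exact: coord_continuous.
Qed.

Lemma rsubmx_continuous m n : continuous (@rsubmx R 1 m n).
Proof.
apply: continuous_rV => i; under eq_fun do rewrite mxE.
exact: coord_continuous.
Qed.

Lemma row_mx_continuous (T : topologicalType) m n (f : T -> 'rV[R]_m) (g : T -> 'rV[R]_n) :
  continuous f -> continuous g -> continuous (fun x => row_mx (f x) (g x)).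
Proof.
move=> cf cg; apply: continuous_rV => i; under eq_fun do rewrite mxE.
case: (fintype.split i) => j.
  move=> x; apply: (@continuous_comp _ _ _ f (fun v : 'rV[R]_m => v 0 j)).
    exact: cf.
  exact: coord_continuous.
move=> x; apply: (@continuous_comp _ _ _ g (fun v : 'rV[R]_n => v 0 j)).
  exact: cg.
exact: coord_continuous.
Qed.

Lemma norm_row_mx_le m n (a : 'rV[R]_m) (b : 'rV[R]_n) M :
  `|a| <= M -> `|b| <= M -> `|row_mx a b| <= M.
Proof.
move=> aM bM; apply: rV_norm_le => [|i]; first exact: le_trans aM.
rewrite mxE; case: (fintype.split i) => j; exact: le_trans (coord_le_norm _ _ _) _.
Qed.

Lemma norm_lsubmx_le m n (z : 'rV[R]_(m + n)) : `|lsubmx z| <= `|z|.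
Proof. by apply: rV_norm_le => // i; rewrite mxE coord_le_norm. Qed.

Lemma norm_rsubmx_le m n (z : 'rV[R]_(m + n)) : `|rsubmx z| <= `|z|.
Proof. by apply: rV_norm_le => // i; rewrite mxE coord_le_norm. Qed.

Lemma near_ge0 (s : R) : 0 < s -> \forall t \near s, 0 <= t.
Proof.
move=> s0; have := nbhsx_ballx s s s0; apply: filterS => t.
by rewrite /ball /= ltr_norml; lra.
Qed.

Lemma is_derive_norm_le n (f : R -> 'rV[R]_n) s w :
  (forall e, 0 < e -> \forall t \near s, `|f t - f s - (t - s) *: w| <= e * `|t - s|) ->
  is_derive s 1 f w.
Proof.
move=> h.
have c : (fun h => h^-1 *: ((f \o shift s) (h *: 1) - f s)) @ 0^' --> w.
  apply/cvgrPdist_le => e e0; have /nbhs_ballP[d /= d0 hd] := h e e0.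
  exists d => //= k; rewrite /ball_ /= sub0r normrN => kd k0.
  have := hd (k + s); rewrite /ball /= opprD addrCA subrr addr0 normrN => /(_ kd).
  rewrite addrK => hk; rewrite distrC [k *: 1]mulr1.
  have -> : k^-1 *: (f (k + s) - f s) - w = k^-1 *: (f (k + s) - f s - k *: w).
    by rewrite [RHS]scalerBr scalerA mulVf // scale1r.
  by rewrite normrZ normfV ler_pdivrMl ?normr_gt0 // mulrC.
by split; [apply/cvg_ex; exists w | exact/cvg_lim].
Qed.

End RowVectorTopology.

(** * Euler polygons, shooting and the limit of vanishing step size *)

Section EulerScheme.
Context {R : realType} (n : nat).
Let V := 'rV[R]_n.
Context (G : V -> V -> V) (B : R).
Hypothesis cG : continuous (fun z : V * V => G z.1 z.2).
Hypothesis bG : forall x v, `|G x v| <= B.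

Section Steps.
Context (h : R) (x v : nat -> V).
Hypothesis h0 : 0 <= h.
Hypothesis xS : forall k, x k.+1 = x k + h *: v k.
Hypothesis vS : forall k, v k.+1 = v k + h *: G (x k) (v k).

Let B0 : 0 <= B. Proof. exact: le_trans (bG 0 0). Qed.

Lemma euler_velocity_add j m w e :
  (forall i, (j <= i < j + m)%N -> `|G (x i) (v i) - w| <= e) ->
  `|v (j + m)%N - v j - (m%:R * h) *: w| <= m%:R * h * e.
Proof.
elim: m => [|m IH] hw.
  by rewrite addn0 subrr mul0r scale0r subr0 normr0 mul0r.
rewrite addnS vS.
have -> : v (j + m)%N + h *: G (x (j + m)%N) (v (j + m)%N) - v j - (m.+1%:R * h) *: w =
   (v (j + m)%N - v j - (m%:R * h) *: w) + h *: (G (x (j + m)%N) (v (j + m)%N) - w).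
  rewrite scalerBr -natr1 mulrDl mul1r scalerDl opprD.
  by rewrite !addrA; congr (_ - _); rewrite -!addrA; congr (_ + _); rewrite addrC addrA.
apply: le_trans (ler_normD _ _) _.
rewrite -natr1 !mulrDl mul1r lerD //.
  by apply: IH => i /andP[ji im]; apply: hw; rewrite ji addnS ltnS ltnW.
by rewrite normrZ ger0_norm // ler_wpM2l // hw // leq_addr /= addnS.
Qed.

Lemma euler_velocity_lip_add j m : `|v (j + m)%N - v j| <= m%:R * h * B.
Proof.
have := euler_velocity_add j m 0 B; rewrite scaler0 subr0; apply=> i _.
by rewrite subr0.
Qed.

Lemma euler_position_add j m :
  `|x (j + m)%N - x j - (m%:R * h) *: v j| <= B * (m%:R * h) ^+ 2.
Proof.
elim: m => [|m IH].
  by rewrite addn0 subrr mul0r scale0r subr0 normr0 expr0n mulr0.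
rewrite addnS xS.
have -> : x (j + m)%N + h *: v (j + m)%N - x j - (m.+1%:R * h) *: v j =
   (x (j + m)%N - x j - (m%:R * h) *: v j) + h *: (v (j + m)%N - v j).
  rewrite scalerBr -natr1 mulrDl mul1r scalerDl opprD.
  by rewrite !addrA; congr (_ - _); rewrite -!addrA; congr (_ + _); rewrite addrC addrA.
apply: le_trans (ler_normD _ _) _.
apply: (@le_trans _ _ (B * (m%:R * h) ^+ 2 + h * (m%:R * h * B))).
  by rewrite lerD // normrZ ger0_norm // ler_wpM2l // euler_velocity_lip_add.
have mR : 0 <= m%:R :> R by [].
have : 0 <= B * h ^+ 2 * m%:R by rewrite !mulr_ge0 // exprn_ge0.
have : 0 <= B * h ^+ 2 by rewrite !mulr_ge0 // exprn_ge0.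
rewrite -natr1; move: (m%:R : R) => M; lra.
Qed.

Let th (k : nat) := k%:R * h.

Lemma euler_velocity_lip k j : `|v k - v j| <= B * `|th k - th j|.
Proof.
wlog jk : k j / (j <= k)%N.
  move=> H; case: (leqP j k) => [|/ltnW] jk; first exact: H.
  by rewrite distrC [`|th k - _|]distrC H.
have := euler_velocity_lip_add j (k - j).
rewrite subnKC // natrB // mulrC mulrBl => hv; apply: le_trans hv _.
by rewrite ler_wpM2l // ler_norm.
Qed.

(** Backwards in time the available expansion uses [v k] instead of [v j]; exchanging the velocities
    doubles the constant. Both directions are needed for two-sided derivatives. *)
Lemma euler_position k j :
  `|x k - x j - (th k - th j) *: v j| <= 2 * B * `|th k - th j| ^+ 2.
Proof.
case: (leqP j k) => [jk|/ltnW kj].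
  have := euler_position_add j (k - j).
  rewrite subnKC // natrB // mulrBl real_normK ?num_real // => hx.
  apply: le_trans hx _; rewrite -mulrA mulr2n mulrDl mul1r lerDl.
  by rewrite mulr_ge0 // sqr_ge0.
have := euler_position_add k (j - k).
rewrite subnKC // natrB // mulrBl => hx.
have hv := euler_velocity_lip k j.
have -> : x k - x j - (th k - th j) *: v j =
  - (x j - x k - (th j - th k) *: v k) + (th k - th j) *: (v k - v j).
  by apply/rowP => i; rewrite !mxE; ring.
apply: le_trans (ler_normD _ _) _; rewrite normrN normrZ.
have := sqr_ge0 (th k - th j).
rewrite -[_ ^+ 2 in X in X -> _]real_normK ?num_real //.
move: hx hv; rewrite -/(th j) -/(th k) -(real_normK (num_real (th j - th k))).
rewrite (distrC (th j)) => hx hv hs.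
apply: le_trans (lerD hx (ler_wpM2l (normr_ge0 _) hv)) _.
by nra.
Qed.

Lemma euler_velocity k j w e :
  (forall i, `|th i - th j| <= `|th k - th j| -> `|G (x i) (v i) - w| <= e) ->
  `|v k - v j - (th k - th j) *: w| <= e * `|th k - th j|.
Proof.
move=> hw.
case: (leqP j k) => [jk|/ltnW kj].
  have := euler_velocity_add j (k - j) w e.
  rewrite subnKC // natrB // mulrBl => /(_ _)/le_trans; apply.
    move=> i /andP[ji ik]; apply: hw.
    rewrite !ger0_norm ?subr_ge0 ?ler_wpM2r ?ler_nat // 1?ltnW //.
    by rewrite lerD2r ler_wpM2r ?ler_nat // ltnW.
  by rewrite mulrC ler_wpM2l ?ler_norm // (le_trans _ (hw j _)) // subrr normr0.
have := euler_velocity_add k (j - k) w e.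
rewrite subnKC // natrB // mulrBl => hx.
have -> : v k - v j - (th k - th j) *: w = - (v j - v k - (th j - th k) *: w).
  by rewrite -[th k - th j]opprB scaleNr opprK opprD opprB opprK.
rewrite normrN; apply: le_trans (hx _) _.
  move=> i /andP[ki ij]; apply: hw.
  rewrite distrC [leRHS]distrC !ger0_norm ?subr_ge0 ?ler_wpM2r ?ler_nat // 1?ltnW //.
  by rewrite lerD2l lerN2 ler_wpM2r ?ler_nat.
rewrite distrC mulrC ler_wpM2l ?ler_norm // (le_trans _ (hw j _)) //.
by rewrite subrr normr0.
Qed.

End Steps.

(** Shooting. With [G = 0], initial data (a, b) lead to a + b at time 1 and a + 2 b at time 2; [Psi]
    corrects (a, b) by the inverse of this linear map applied to the errors at [p] and [q]. A fixed
    point has no errors, and [Psi] is bounded because the linear parts cancel, leaving [p], [q] and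
    deviations of size [B] and [4 * B]. *)
Lemma euler_bvp (p q : V) (N : nat) : (0 < n)%N -> exists x v : nat -> V,
  [/\ (forall k, x k.+1 = x k + N.+1%:R^-1 *: v k),
      (forall k, v k.+1 = v k + N.+1%:R^-1 *: G (x k) (v k)),
      x N.+1 = p, x (2 * N.+1)%N = q &
      `|x 0%N| <= 2 * `|p| + 2 * `|q| + 6 * B /\ `|v 0%N| <= 2 * `|p| + 2 * `|q| + 6 * B].
Proof.
move=> n0; pose h : R := N.+1%:R^-1.
have h0 : 0 <= h by rewrite invr_ge0.
have B0 : 0 <= B := le_trans (normr_ge0 _) (bG 0 0).
pose step (z : V * V) := (z.1 + h *: z.2, z.2 + h *: G z.1 z.2).
pose st k (z : 'rV[R]_(n + n)) := iter k step (lsubmx z, rsubmx z).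
have cst1 k : continuous (st k).
  elim: k => [|k IH] z; rewrite /st /=.
    exact: (cvg_pair (@lsubmx_continuous R n n z) (@rsubmx_continuous R n n z)).
  have c1 : (fun z => (st k z).1) @ z --> (st k z).1.
    by apply: (cvg_comp _ _ (IH z)); exact: cvg_fst.
  have c2 : (fun z => (st k z).2) @ z --> (st k z).2.
    by apply: (cvg_comp _ _ (IH z)); exact: cvg_snd.
  have c3 : (fun z => G (st k z).1 (st k z).2) @ z --> G (st k z).1 (st k z).2.
    exact: (cvg_comp _ _ (IH z) (@cG (st k z))).
  exact: (cvg_pair (cvgD c1 (cvgZl_tmp c2)) (cvgD c2 (cvgZl_tmp c3))).
have cx k : continuous (fun z => (st k z).1).
  by move=> z; apply: (cvg_comp _ _ (cst1 k z)); exact: cvg_fst.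
pose X1 z := (st N.+1 z).1; pose X2 z := (st (2 * N.+1)%N z).1.
have cX1 z : (fun z => X1 z - p) @ z --> X1 z - p.
  exact: (cvgB (cx N.+1 z) (cvg_cst p)).
have cX2 z : (fun z => X2 z - q) @ z --> X2 z - q.
  exact: (cvgB (cx (2 * N.+1)%N z) (cvg_cst q)).
pose Psi z : 'rV[R]_(n + n) := row_mx
  (lsubmx z - 2 *: (X1 z - p) + (X2 z - q)) (rsubmx z + (X1 z - p) - (X2 z - q)).
have est k z : `|(st k z).1 - lsubmx z - (k%:R * h) *: rsubmx z| <= B * (k%:R * h) ^+ 2.
  by apply: (euler_position_add h (fun k => (st k z).1) (fun k => (st k z).2) h0 _ _ 0 k).
have e1 z : `|X1 z - lsubmx z - rsubmx z| <= B.
  by have := est N.+1 z; rewrite divff ?pnatr_eq0 // scale1r expr1n mulr1.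
have e2 z : `|X2 z - lsubmx z - 2 *: rsubmx z| <= 4 * B.
  have := est (2 * N.+1)%N z; rewrite natrM -mulrA divff ?pnatr_eq0 // mulr1.
  by rewrite [B * _]mulrC -natrX.
have bPsi z : `|Psi z| <= 2 * `|p| + 2 * `|q| + 6 * B.
  apply: norm_row_mx_le.
    have -> : lsubmx z - 2 *: (X1 z - p) + (X2 z - q) = 2 *: p - q
       - 2 *: (X1 z - lsubmx z - rsubmx z) + (X2 z - lsubmx z - 2 *: rsubmx z).
      by apply/rowP => i; rewrite !mxE; ring.
    apply: (le_trans (ler_normD _ _)); apply: (le_trans (lerD (ler_normB _ _) (e2 z))).
    apply: (le_trans (lerD (lerD (ler_normB _ _) (lexx _)) (lexx _))).
    rewrite !normrZ (ger0_norm (ler0n _ 2)); have := e1 z.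
    by have := normr_ge0 p; have := normr_ge0 q; lra.
  have -> : rsubmx z + (X1 z - p) - (X2 z - q) = q - p
     + (X1 z - lsubmx z - rsubmx z) - (X2 z - lsubmx z - 2 *: rsubmx z).
    by apply/rowP => i; rewrite !mxE; ring.
  apply: (le_trans (ler_normB _ _)); apply: (le_trans (lerD (ler_normD _ _) (e2 z))).
  apply: (le_trans (lerD (lerD (ler_normB _ _) (e1 z)) (lexx _))).
  by have := normr_ge0 p; have := normr_ge0 q; lra.
have [|||z Pz] := @brouwer R (n + n) Psi (2 * `|p| + 2 * `|q| + 6 * B).
- by rewrite addn_gt0 n0.
- apply: row_mx_continuous => z.
    exact: (cvgD (cvgB (@lsubmx_continuous R n n z) (cvgZl_tmp (cX1 z))) (cX2 z)).
  exact: (cvgB (cvgD (@rsubmx_continuous R n n z) (cX1 z)) (cX2 z)).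
- exact: bPsi.
have bz : `|z| <= 2 * `|p| + 2 * `|q| + 6 * B.
  by rewrite -{1}Pz.
have f1 : lsubmx z - 2 *: (X1 z - p) + (X2 z - q) = lsubmx z.
  by rewrite -[in RHS]Pz row_mxKl.
have f2 : rsubmx z + (X1 z - p) - (X2 z - q) = rsubmx z.
  by rewrite -[in RHS]Pz row_mxKr.
exists (fun k => (st k z).1), (fun k => (st k z).2); split=> //.
- apply/rowP => i; move/rowP/(_ i): f1; move/rowP/(_ i): f2; rewrite !mxE /X1.
  by lra.
- apply/rowP => i; move/rowP/(_ i): f1; move/rowP/(_ i): f2; rewrite !mxE /X2.
  by lra.
- split; apply: le_trans bz; [exact: norm_lsubmx_le|exact: norm_rsubmx_le].
Qed.

(* The initial time is 0, one unit before the solution reaches [p], so that it is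
   also defined around both end points. *)
Lemma bvp_solution (p q : V) : (0 < n)%N -> exists x v : R -> V,
  [/\ forall t : R, 0 < t -> is_derive t 1 x (v t),
      forall t : R, 0 < t -> is_derive t 1 v (G (x t) (v t)),
      x 1 = p & x 2 = q].
Proof.
move=> n0.
have B0 : 0 <= B := le_trans (normr_ge0 _) (bG 0 0).
set L := 2 * `|p| + 2 * `|q| + 6 * B.
have ex N : exists xv : (nat -> V) * (nat -> V),
  [/\ (forall k, xv.1 k.+1 = xv.1 k + N.+1%:R^-1 *: xv.2 k),
      (forall k, xv.2 k.+1 = xv.2 k + N.+1%:R^-1 *: G (xv.1 k) (xv.2 k)),
      xv.1 N.+1 = p, xv.1 (2 * N.+1)%N = q &
      `|xv.1 0%N| <= L /\ `|xv.2 0%N| <= L].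
  by have [x [v H]] := euler_bvp p q N n0; exists (x, v).
have [xv hxv] := choice ex.
have h0 N : 0 <= N.+1%:R^-1 :> R by rewrite invr_ge0.
pose idx N (t : R) := Num.trunc (t * N.+1%:R).
pose th N (t : R) : R := (idx N t)%:R * N.+1%:R^-1.
pose X N t := (xv N).1 (idx N t).
pose Y N t := (xv N).2 (idx N t).
have [U [UU oU]] := ultra_nat.
have th_abs N t : 0 <= th N t <= `|t|.
  rewrite divr_ge0 //= ler_pdivrMr ?ltr0n //.
  apply: (@le_trans _ _ `|t * N.+1%:R|); last by rewrite normrM (ger0_norm (ler0n _ _)).
  case: (leP 0 (t * N.+1%:R)) => ht; first by rewrite ger0_norm // /idx truncn_le.
  have -> : idx N t = 0%N by apply/truncn0Pn; rewrite -ltNge (lt_trans ht).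
  exact: normr_ge0.
have th_near N t : 0 <= t -> `|th N t - t| <= N.+1%:R^-1.
  move=> t0; have /truncn_itv/andP[h1 h2] : 0 <= t * N.+1%:R by rewrite mulr_ge0.
  rewrite -(@ler_pM2r _ N.+1%:R) ?ltr0n // mulVf ?pnatr_eq0 //.
  rewrite -[X in _ * X](ger0_norm (ler0n R N.+1)) -normrM mulrBl /th divfK ?pnatr_eq0 //.
  move: h1 h2; rewrite -/(idx N t) -[(idx N t).+1%:R]natr1 => h1 h2.
  by rewrite ler_norml; lra.
have th_cvg t : 0 <= t -> th^~ t @ U --> t.
  move=> t0; apply/cvgrPdist_lt => e e0; apply: oU.
  have := near_infty_natSinv_lt (PosNum e0); apply: filterS => N /=.
  by rewrite distrC; apply: le_lt_trans; exact: th_near.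
have posN N k j : `|(xv N).1 k - (xv N).1 j - (k%:R * N.+1%:R^-1 - j%:R * N.+1%:R^-1) *: (xv N).2 j|
    <= 2 * B * `|k%:R * N.+1%:R^-1 - j%:R * N.+1%:R^-1| ^+ 2.
  by have [xS vS _ _ _] := hxv N; exact: euler_position.
have velN N k j : `|(xv N).2 k - (xv N).2 j| <= B * `|k%:R * N.+1%:R^-1 - j%:R * N.+1%:R^-1|.
  by have [xS vS _ _ _] := hxv N; exact: (euler_velocity_lip _ _ _ (h0 N) vS).
have Yb N t : `|Y N t| <= L + B * `|t|.
  have [_ _ _ _ [_ v0]] := hxv N; have := velN N (idx N t) 0%N.
  rewrite mul0r subr0 => hv; rewrite -[Y N t](subrK ((xv N).2 0%N)) addrC.
  apply: le_trans (ler_normD _ _) _; rewrite lerD //; apply: le_trans hv _.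
  by rewrite ler_wpM2l // ger0_norm; case/andP: (th_abs N t).
have Xb N t : `|X N t| <= L + `|t| * L + 2 * B * `|t| ^+ 2.
  have [_ _ _ _ [x0 v0]] := hxv N; have := posN N (idx N t) 0%N.
  rewrite mul0r subr0 => hv; have /andP[t1 t2] := th_abs N t.
  have -> : X N t = (xv N).1 0%N + th N t *: (xv N).2 0%N +
     ((xv N).1 (idx N t) - (xv N).1 0%N - th N t *: (xv N).2 0%N).
    by apply/rowP => i; rewrite !mxE; ring.
  apply: le_trans (ler_normD _ _) _; rewrite lerD //; last first.
    apply: le_trans hv _; rewrite ler_wpM2l ?mulr_ge0 // (ger0_norm t1).
    by rewrite lerXn2r ?nnegrE.
  apply: le_trans (ler_normD _ _) _; rewrite lerD // normrZ (ger0_norm t1).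
  by rewrite ler_pM.
have exx t : exists l : V, X^~ t @ U --> l by apply: ultra_cvg => k; exact: Xb.
have exv t : exists l : V, Y^~ t @ U --> l by apply: ultra_cvg => k; exact: Yb.
have [x hx] := choice exx; have [v hv] := choice exv.
(* The expansion of the polygons survives in the limit; its quadratic error is what makes [v] the
   derivative of [x]. *)
have x_est s t : 0 <= s -> 0 <= t ->
    `|x t - x s - (t - s) *: v s| <= 2 * B * `|t - s| ^+ 2.
  move=> s0 t0; have cd : (fun N => th N t - th N s) @ U --> t - s.
    by apply: cvgB; exact: th_cvg.
  apply: (@ler_cvg_to _ U _ _ (fun N => `|X N t - X N s - (th N t - th N s) *: Y N s|)
    (fun N => 2 * B * `|th N t - th N s| ^+ 2)).
  - apply: cvg_norm; apply: cvgB; first by apply: cvgB; exact: hx.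
    by apply: cvgZ => //; exact: hv.
  - apply: cvgM; first exact: cvg_cst.
    rewrite expr2; under eq_fun do rewrite expr2.
    by apply: cvgM; exact: cvg_norm.
  - by apply: filterE => N; exact: posN.
exists x, v; split.
- move=> s s0; apply: is_derive_norm_le => e e0.
  have c0 : 0 < e / (2 * B + 1) by rewrite divr_gt0 // ltr_wpDl // mulr_ge0.
  near=> t; apply: le_trans (x_est s t (ltW s0) _) _.
    by near: t; exact: near_ge0.
  rewrite expr2 mulrA ler_wpM2r //.
  apply: (@le_trans _ _ ((2 * B + 1) * `|t - s|)); first by rewrite ler_wpM2r // lerDl.
  rewrite mulrC -ler_pdivlMr; last by rewrite ltr_wpDl // mulr_ge0.
  apply: ltW; near: t; have := nbhsx_ballx s _ c0.
  by apply: filterS => t; rewrite /ball /= distrC.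
- move=> s s0; apply: is_derive_norm_le => e e0.
  have /cvgrPdist_le/(_ e e0)/nbhs_ballP[d0 /= d00 hd] := cG (x s, v s).
  (* For large [N], the states of the polygon within a time distance D <= 1 of [s] differ from the
     one at [s] by at most [D * M] in position and in velocity. So they stay where [G] is within [e]
     of its value at the limit. *)
  pose M := `|v s| + 1 + 2 * B + B.
  have M0 : 0 < M by rewrite /M; have := normr_ge0 (v s); lra.
  pose d := Num.min 1 (d0 / (2 * M)).
  have d_gt0 : 0 < d by rewrite lt_min ltr01 divr_gt0 // mulr_gt0.
  near=> t.
  have t0 : 0 <= t by near: t; exact: near_ge0.
  have td : `|t - s| < d.
    near: t; have := nbhsx_ballx s d d_gt0.
    by apply: filterS => t; rewrite /ball /= distrC.
  have cd : (fun N => th N t - th N s) @ U --> t - s.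
    by apply: cvgB; apply: th_cvg => //; exact: ltW.
  have c2 : 0 < Num.min 1 (d0 / 2) by rewrite lt_min ltr01 divr_gt0.
  apply: (@ler_cvg_to _ U _ _
    (fun N => `|Y N t - Y N s - (th N t - th N s) *: G (x s) (v s)|)
    (fun N => e * `|th N t - th N s|)).
  - apply: cvg_norm; apply: cvgB; first by apply: cvgB; exact: hv.
    by apply: cvgZ => //; exact: cvg_cst.
  - by apply: cvgM; [exact: cvg_cst|exact: cvg_norm].
  have /cvgrPdist_lt/(_ _ c2) n1 := hv s.
  have /cvgrPdist_lt/(_ _ c2) n2 := hx s.
  have n3 : \forall N \near U, `|th N t - th N s| < d.
    have /cvgrPdist_lt/(_ (d - `|t - s|)) := cd; rewrite subr_gt0 => /(_ td).
    apply: filterS => N; rewrite ltrBrDl => h; apply: le_lt_trans h.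
    set a := _ - _; set b := t - s.
    rewrite [X in `|X| <= _](_ : _ = b - (b - a)); first exact: ler_normB.
    by rewrite opprB addrC subrK.
  move: n1 n2 n3; apply: filterS3 => N hv1 hx1 hd1.
  have [xS vS _ _ _] := hxv N.
  apply: (euler_velocity _ _ _ (h0 N) vS) => i hi.
  have {}hi : `|i%:R * N.+1%:R^-1 - th N s| <= `|th N t - th N s| := hi.
  have := hd ((xv N).1 i, (xv N).2 i); rewrite distrC; apply.
  have Dd := le_lt_trans hi hd1.
  set D := `|i%:R * N.+1%:R^-1 - th N s| in hi Dd.
  have D0 : 0 <= D by exact: normr_ge0.
  have D1 : D < 1 by apply: lt_le_trans Dd _; rewrite ge_min lexx.
  have DM : D * M < d0 / 2.
    rewrite -ltr_pdivlMr //; apply: lt_le_trans Dd _.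
    by rewrite ge_min -mulrA -invfM lexx orbT.
  move: hv1 hx1; rewrite !lt_min => /andP[hv1 hv2] /andP[hx1 hx2].
  have vi := velN N i (idx N s); have xi := posN N i (idx N s).
  have Ys : `|Y N s| <= `|v s| + 1.
    rewrite -[Y N s](subrK (v s)) addrC (le_trans (ler_normD _ _)) //.
    by rewrite lerD2l distrC ltW.
  split; rewrite /= -ball_normE /=.
    have -> : x s - (xv N).1 i = (x s - X N s) -
      ((i%:R * N.+1%:R^-1 - th N s) *: Y N s) -
      ((xv N).1 i - (xv N).1 (idx N s) - (i%:R * N.+1%:R^-1 - th N s) *: Y N s).
      by apply/rowP => k; rewrite !mxE; ring.
    apply: le_lt_trans (ler_normB _ _) _.
    apply: le_lt_trans (lerD (ler_normB _ _) xi) _; rewrite normrZ.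
    rewrite -/(th N s) -/D.
    have : D * `|Y N s| <= D * (`|v s| + 1) by rewrite ler_wpM2l.
    have : 2 * B * D ^+ 2 <= 2 * B * D.
      by rewrite ler_wpM2l ?mulr_ge0 // expr2 ler_piMr // ltW.
    have : 0 <= D * B by rewrite mulr_ge0.
    by move: DM; rewrite /M; lra.
  have -> : v s - (xv N).2 i = (v s - Y N s) - ((xv N).2 i - Y N s).
    by apply/rowP => k; rewrite !mxE; ring.
  apply: le_lt_trans (ler_normB _ _) _.
  apply: le_lt_trans (lerD (lexx _) vi) _; rewrite -/(th N s) -/D.
  have : 0 <= D * (`|v s| + 1 + 2 * B) by rewrite mulr_ge0 // !addr_ge0 // mulr_ge0.
  by move: DM; rewrite /M; lra.
- have := hx 1; rewrite (_ : X^~ 1 = fun=> p); last first.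
    by apply/funext => N; rewrite /X /idx mul1r natrK; have [] := hxv N.
  by move=> h1; apply: (cvg_unique _ h1 (cvg_cst p)); exact: norm_hausdorff.
- have := hx 2; rewrite (_ : X^~ 2 = fun=> q); last first.
    by apply/funext => N; rewrite /X /idx -natrM natrK; have [] := hxv N.
  by move=> h1; apply: (cvg_unique _ h1 (cvg_cst q)); exact: norm_hausdorff.
Unshelve. all: by end_near. Qed.

End EulerScheme.

(** * Calculus of C^k functions *)

Section CkCalculus.
Context {R : realType}.

Lemma near_eq_differentiable (V W : normedModType R) (f g : V -> W) (x : V) :
  (\near x, f x = g x) -> differentiable f x -> differentiable g x.
Proof.
move=> fg df; have fgx : f x = g x := nbhs_singleton fg.
have [dfc /eqaddoP dfo] := (diff_locallyP _ _).1 df.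
have go : g \o shift x = cst (g x) + 'd f x +o_ 0 id.
  apply/eqaddoP => e e0; have := dfo e e0.
  have fg0 : \forall h \near (0 : V), f (h + x) = g (h + x).
    have c : (fun h : V => h + x) @ (0 : V) --> 0 + x.
      by apply: cvgD; [exact: cvg_id|exact: cvg_cst].
    by apply: (c [set y | f y = g y]); rewrite add0r.
  apply: filterS2 fg0 => h /= e1.
  by rewrite /= !fctE /= e1 fgx.
have dg := diff_unique dfc go.
by apply/diff_locallyP; rewrite dg.
Qed.

Section Basics.
Context {V : normedModType R}.
Implicit Type U : set V.

(** Openness turns equality on [U] into equality of germs, so that derivatives may be replaced by
    formulas valid only on [U]. *)
Lemma Ck_on_ext (W : normedModType R) k U (f g : V -> W) : open U ->
  (forall x, U x -> f x = g x) -> Ck_on k U f -> Ck_on k U g.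
Proof.
move=> oU; have nU x : U x -> nbhs x U by move=> Ux; exact: open_nbhs_nbhs.
elim: k f g => [|k IH] f g fg /=.
  move=> cf x Ux; rewrite /prop_for /continuous_at -(fg x Ux).
  apply: cvg_trans (cf x Ux); apply: near_eq_cvg.
  by apply: filterS (nU x Ux) => y Uy; rewrite fg.
move=> [df Df]; split=> [x Ux|v].
  by apply: near_eq_differentiable (df x Ux); apply: filterS (nU x Ux) => y; exact: fg.
apply: IH (Df v) => x Ux; apply: near_eq_derive.
by apply: filterS (nU x Ux) => y; exact: fg.
Qed.

Lemma Ck_onS (W : normedModType R) k U (f : V -> W) : Ck_on k.+1 U f -> Ck_on k U f.
Proof.
elim: k f => [|k IH] f /= [df Df].
  by move=> x /df; exact: differentiable_continuous.
by split=> // v; apply: IH; exact: Df.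
Qed.

Lemma Ck_on_cst (W : normedModType R) k U (a : W) : Ck_on k U (fun=> a).
Proof.
elim: k a => [|k IH] a /=; first by move=> x _; exact: cvg_cst.
split=> [x _|v]; first exact: differentiable_cst.
by under eq_fun do rewrite (derive_cst a); exact: IH.
Qed.

Lemma Ck_on_linear (W : normedModType R) k U (f : {linear V -> W}) :
  continuous f -> Ck_on k U f.
Proof.
move=> cf; case: k => [|k] /=; first by move=> x _; exact: cf.
split=> [x _|v]; first exact: linear_differentiable.
have -> : (fun x => 'D_v f x) = fun=> f v.
  apply/funext => x; rewrite deriveE; last exact: linear_differentiable.
  by rewrite diff_lin.
exact: Ck_on_cst.
Qed.

Lemma Ck_onD (W : normedModType R) k U (f g : V -> W) : open U ->
  Ck_on k U f -> Ck_on k U g -> Ck_on k U (fun x => f x + g x).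
Proof.
move=> oU; elim: k f g => [|k IH] f g /=.
  by move=> cf cg x Ux; apply: cvgD; [exact: cf|exact: cg].
move=> [df Df] [dg Dg]; split=> [x Ux|v].
  exact: (differentiableD (df x Ux) (dg x Ux)).
apply: Ck_on_ext (IH _ _ (Df v) (Dg v)) => // x Ux; apply/esym.
by apply: deriveD; apply: diff_derivable; [exact: df|exact: dg].
Qed.

Lemma Ck_on_sum (W : normedModType R) k U m (f : 'I_m -> V -> W) : open U ->
  (forall i, Ck_on k U (f i)) -> Ck_on k U (fun x => \sum_i f i x).
Proof.
move=> oU; elim: m f => [|m IH] f cf.
  by under eq_fun do rewrite big_ord0; exact: Ck_on_cst.
under eq_fun do rewrite big_ord_recl.
apply: (@Ck_onD W k U (f ord0) (fun x => \sum_i f (lift ord0 i) x)) => //.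
by apply: IH => i; exact: cf.
Qed.

Lemma Ck_onM k U (f g : V -> R) : open U ->
  Ck_on k U f -> Ck_on k U g -> Ck_on k U (fun x => f x * g x).
Proof.
move=> oU; elim: k f g => [|k IH] f g.
  by move=> cf cg x Ux; apply: cvgM; [exact: cf|exact: cg].
move=> cf cg; have [df Df] := cf; have [dg Dg] := cg; split=> [x Ux|v].
  exact: (differentiableM (df x Ux) (dg x Ux)).
apply: (@Ck_on_ext _ k U (fun x => f x * 'D_v g x + g x * 'D_v f x)) => //.
  move=> x Ux; apply/esym.
  by apply: deriveM; apply: diff_derivable; [exact: df|exact: dg].
by apply: Ck_onD => //; apply: IH; first [exact: Ck_onS | exact: Dg | exact: Df].
Qed.

Lemma Ck_onN k U (f : V -> R) : open U -> Ck_on k U f -> Ck_on k U (fun x => - f x).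
Proof.
move=> oU cf; under eq_fun do rewrite -mulN1r.
by apply: Ck_onM => //; exact: Ck_on_cst.
Qed.

Lemma Ck_onV k U (f : V -> R) : open U -> (forall x, U x -> f x != 0) ->
  Ck_on k U f -> Ck_on k U (fun x => (f x)^-1).
Proof.
move=> oU f0; elim: k => [|k IH] cf.
  by move=> x Ux; apply: cvgV; [exact: f0|exact: cf].
have [df Df] := cf; split=> [x Ux|v].
  by apply: differentiableV; [exact: df|exact: f0].
have IHk := IH (Ck_onS _ _ _ _ cf).
apply: (@Ck_on_ext _ k U (fun x => - ((f x)^-1 * ((f x)^-1 * 'D_v f x)))) => //.
  move=> x Ux; apply/esym; rewrite (deriveV (f0 x Ux)); last exact/diff_derivable/df.
  by rewrite /GRing.scale /= mulNr expr2 invfM mulrA.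
by apply: Ck_onN => //; apply: Ck_onM => //; apply: Ck_onM => //; exact: Df.
Qed.

Lemma derive_coord m (f : V -> 'rV[R]_m) i x v : differentiable f x ->
  'D_v (fun x => f x 0 i) x = ('D_v f x) 0 i.
Proof.
move=> df; apply: cvg_lim => //.
have c : (fun h => h^-1 *: ((f \o shift x) (h *: v) - f x)) @ (0 : R)^' --> 'D_v f x.
  exact: diff_derivable.
have := cvg_comp _ _ c (@coord_continuous R 1 m 0 i _).
by apply: cvg_trans; apply: near_eq_cvg; apply: filterE => h /=; rewrite !mxE.
Qed.

Lemma Ck_on_coord k U m (f : V -> 'rV[R]_m) i : open U ->
  Ck_on k U f -> Ck_on k U (fun x => f x 0 i).
Proof.
move=> oU; elim: k f => [|k IH] f.
  move=> cf x Ux; apply: (@continuous_comp _ _ _ f (fun v : 'rV[R]_m => v 0 i)).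
    exact: cf.
  exact: coord_continuous.
move=> [df Df].
have dcf x : U x -> differentiable (fun x => f x 0 i) x.
  move=> Ux; apply: (@differentiable_comp _ _ _ _ f (fun v : 'rV[R]_m => v 0 i)).
    exact: df.
  exact: differentiable_coord.
split=> // v; apply: Ck_on_ext (IH _ (Df v)) => // x Ux.
by rewrite -derive_coord //; exact: df.
Qed.

Lemma differentiable_rV m (f : V -> 'rV[R]_m) x :
  (forall i, differentiable (fun x => f x 0 i) x) -> differentiable f x.
Proof.
move=> df; have -> : f = \sum_i (fun x => f x 0 i *: delta_mx 0 i).
  apply/funext => y; rewrite fct_sumE; apply/rowP => j; rewrite summxE.
  rewrite (bigD1 j) //= !mxE !eqxx mulr1 big1 ?addr0 // => i ij.
  by rewrite !mxE eq_sym (negPf ij) andbF mulr0.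
by apply: differentiable_sum => i; exact: differentiableZl.
Qed.

Lemma Ck_on_rV k U m (f : V -> 'rV[R]_m) : open U ->
  (forall i, Ck_on k U (fun x => f x 0 i)) -> Ck_on k U f.
Proof.
move=> oU; elim: k f => [|k IH] f cf.
  by move=> x Ux; apply: cvg_rV => i; exact: (cf i).
have df x : U x -> differentiable f x.
  by move=> Ux; apply: differentiable_rV => i; have [+ _] := cf i; apply.
split=> // v; apply: IH => i; have [_ /(_ v)] := cf i.
by apply: Ck_on_ext => // x Ux; apply: derive_coord; exact: df.
Qed.

Lemma derive_comp_R (s : R -> R) (f : V -> R) x v :
  differentiable s (f x) -> differentiable f x ->
  'D_v (s \o f) x = 'D_1 s (f x) * 'D_v f x.
Proof.
move=> ds df; rewrite deriveE; last exact: differentiable_comp.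
rewrite diff_comp //= [in RHS]deriveE // [in RHS]deriveE //.
by rewrite -[in LHS](mulr1 ('d f x v)) -[X in 'd s _ X]/(_ *: _) linearZ /= mulrC.
Qed.

Lemma Ck_on_comp_R k U (A : set R) (s : R -> R) (f : V -> R) : open U ->
  (forall x, U x -> A (f x)) -> Ck_on k A s -> Ck_on k U f -> Ck_on k U (s \o f).
Proof.
move=> oU UA; elim: k s => [|k IH] s.
  by move=> cs cf x Ux; apply: continuous_comp; [exact: cf|apply: cs; exact: UA].
move=> [ds Ds] cf; have [df Df] := cf; split=> [x Ux|v].
  by apply: differentiable_comp; [exact: df|apply: ds; exact: UA].
apply: (@Ck_on_ext _ k U (fun x => ('D_1 s \o f) x * 'D_v f x)) => //.
  move=> x Ux; apply/esym/derive_comp_R; [apply: ds; exact: UA|exact: df].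
apply: Ck_onM => //; last exact: Df.
by apply: (IH (fun y => 'D_1 s y)); [exact: Ds|exact: Ck_onS].
Qed.

Lemma derive_sum_coord m (g : 'rV[R]_m -> R) y w : differentiable g y ->
  'D_w g y = \sum_i 'D_(coord_vec i) g y * w 0 i.
Proof.
move=> dg; rewrite deriveE // [in LHS](row_sum_delta w) linear_sum /=.
by apply: eq_bigr => i _; rewrite linearZ /= deriveE // mulrC.
Qed.

Lemma derive_comp_rV m (g : 'rV[R]_m -> R) (h : V -> 'rV[R]_m) x v :
  differentiable g (h x) -> differentiable h x ->
  'D_v (g \o h) x = \sum_i 'D_(coord_vec i) g (h x) * ('D_v h x) 0 i.
Proof.
move=> dg dh; rewrite deriveE; last exact: differentiable_comp.
by rewrite diff_comp //= -derive_sum_coord // deriveE // deriveE.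
Qed.

(** The induction is for all [g] at once, because the chain rule composes the partial derivatives of
    [g] with the same [h]. *)
Lemma Ck_on_comp k U m (A : set 'rV[R]_m) (g : 'rV[R]_m -> R) (h : V -> 'rV[R]_m) :
  open U -> (forall x, U x -> A (h x)) -> Ck_on k A g -> Ck_on k U h ->
  Ck_on k U (g \o h).
Proof.
move=> oU UA; elim: k g => [|k IH] g.
  by move=> cg ch x Ux; apply: continuous_comp; [exact: ch|apply: cg; exact: UA].
move=> [dg Dg] ch; have [dh Dh] := ch; split=> [x Ux|v].
  by apply: differentiable_comp; [exact: dh|apply: dg; exact: UA].
apply: (@Ck_on_ext _ k U
  (fun x => \sum_i (fun y => 'D_(coord_vec i) g y) (h x) * ('D_v h x) 0 i)) => //.
  move=> x Ux; apply/esym/derive_comp_rV; [apply: dg; exact: UA|exact: dh].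
apply: Ck_on_sum => // i; apply: Ck_onM => //; last by apply: Ck_on_coord => //; exact: Dh.
by apply: (IH (fun y => 'D_(coord_vec i) g y)); [exact: Dg|exact: Ck_onS].
Qed.

End Basics.

Lemma derive_symmetric (V : normedModType R) (u : V -> R) (a b x : V) :
  Ck_on 2 setT u -> 'D_a (fun y => 'D_b u y) x = 'D_b (fun y => 'D_a u y) x.
Proof.
move=> cu.
(* Both sides are limits of the same symmetric second difference quotient. *)
have key (c d : V) e : 0 < e -> \forall h \near (0 : R)^'+,
  `|(u (x + h *: c + h *: d) - u (x + h *: c) - u (x + h *: d) + u x) / h ^+ 2
    - 'D_d (fun y => 'D_c u y) x| <= e.
  move=> e0.
  have [du Du] := cu; have [ddu DDu] := Du c.
  have /cvgrPdist_le/(_ e e0)/nbhs_normP[r /= r0 hr] := DDu d x I.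
  pose M := `|c| + `|d| + 1; have M0 : 0 < M by rewrite ltr_wpDl // addr_ge0.
  have dir (g : V -> R) (w z : V) : (forall y, differentiable g y) ->
      forall t : R, is_derive t 1 (fun t => g (z + t *: w)) ('D_w g (z + t *: w)).
    move=> dg t.
    have dl : is_diff t (fun t : R => z + t *: w) (fun s : R => s *: w).
      apply: is_diff_eq; rewrite /=. by rewrite add0r.
    split.
      apply/derivable1_diffP.
      by apply: (@differentiable_comp _ _ _ _ (fun t : R => z + t *: w) g).
    rewrite deriveE; last by apply: (@differentiable_comp _ _ _ _ (fun t : R => z + t *: w) g).
    rewrite (@diff_comp _ _ _ _ (fun t : R => z + t *: w) g) //=.
    by rewrite diff_val scale1r deriveE.
  have nr : \forall h \near (0 : R)^'+, h < r / M by apply: nbhs_right_lt; rewrite divr_gt0.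
  have n0 : \forall h \near (0 : R)^'+, 0 < h by exact: nbhs_right_gt.
  apply: filterS2 nr n0 => h hrM h0.
  (* The second difference is the increment of [phi] over [0, h]: the mean value theorem along [c],
     then along [d], makes it a mixed derivative at a nearby point. *)
  pose phi (t : R) := u (x + h *: d + t *: c) - u (x + t *: c).
  have dphi (t : R) : is_derive t 1 phi ('D_c u (x + h *: d + t *: c) - 'D_c u (x + t *: c)).
    by apply: is_deriveB; apply: dir => y; exact: du.
  have [t1 t1h e1] : exists2 t, t \in `]0, h[%R & phi h - phi 0 =
      ('D_c u (x + h *: d + t *: c) - 'D_c u (x + t *: c)) * (h - 0).
    apply: (@MVT R phi) => //.
    by apply: derivable_within_continuous => t _; have [] := dphi t.
  pose psi (s : R) := 'D_c u (x + t1 *: c + s *: d).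
  have dpsi (s : R) : is_derive s 1 psi ('D_d (fun y => 'D_c u y) (x + t1 *: c + s *: d)).
    by apply: (dir (fun y => 'D_c u y)) => y; exact: ddu.
  have [s1 s1h e2] : exists2 s, s \in `]0, h[%R & psi h - psi 0 =
      'D_d (fun y => 'D_c u y) (x + t1 *: c + s *: d) * (h - 0).
    apply: (@MVT R psi) => //.
    by apply: derivable_within_continuous => t _; have [] := dpsi t.
  have -> : (u (x + h *: c + h *: d) - u (x + h *: c) - u (x + h *: d) + u x) / h ^+ 2
      = 'D_d (fun y => 'D_c u y) (x + t1 *: c + s1 *: d).
    have -> : u (x + h *: c + h *: d) - u (x + h *: c) - u (x + h *: d) + u x = phi h - phi 0.
      by rewrite /phi scale0r !addr0 [x + h *: d + _]addrAC; ring.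
    rewrite e1 [x + h *: d + _]addrAC.
    have -> : 'D_c u (x + t1 *: c + h *: d) - 'D_c u (x + t1 *: c) = psi h - psi 0.
      by rewrite /psi scale0r addr0.
    by rewrite e2 subr0 -mulrA -expr2 mulfK // expf_neq0 // gt_eqF.
  rewrite distrC; apply: hr => /=.
  rewrite -!addrA opprD addrA subrr add0r normrN.
  apply: le_lt_trans (ler_normD _ _) _; rewrite !normrZ.
  move: t1h s1h; rewrite !in_itv /= => /andP[a1 a2] /andP[b1 b2].
  rewrite !gtr0_norm //.
  apply: (@le_lt_trans _ _ (h * (`|c| + `|d|))).
    by rewrite mulrDr lerD // ler_wpM2r // ltW.
  apply: (@lt_trans _ _ (h * M)); first by rewrite ltr_pM2l // ltrDl.
  by rewrite -ltr_pdivlMr.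
apply/eqP; rewrite -subr_eq0 -normr_le0; apply/ler_addgt0Pr => e e0; rewrite add0r.
have e2 : 0 < e / 2 by rewrite divr_gt0.
have [h [h1 h2]] := filter_ex (filterI (key a b _ e2) (key b a _ e2)).
rewrite [e]splitr; move: h1 h2.
have -> : u (x + h *: b + h *: a) - u (x + h *: b) - u (x + h *: a) + u x =
   u (x + h *: a + h *: b) - u (x + h *: a) - u (x + h *: b) + u x.
  by rewrite [x + h *: b + _]addrAC; ring.
set q := _ / _; set dab := 'D_b _ x; set dba := 'D_a _ x => h1 h2.
have -> : dba - dab = (q - dab) - (q - dba) by ring.
exact: le_trans (ler_normB _ _) (lerD h1 h2).
Qed.

End CkCalculus.

(** * A priori speed bound *)

Section SpeedBound.
Context {R : realType}.
Implicit Types (g : R -> R) (a b t : R).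

Lemma is_derive_affine_id (a b t : R) : is_derive t 1 (fun t => a + b * t) b.
Proof.
have d := is_deriveD (is_derive_cst a t 1)
  (is_deriveM (is_derive_cst b t 1) (is_derive_id t 1)).
apply: is_derive_eq d _.
by rewrite add0r scaler0 addr0 [b *: 1]mulr1.
Qed.

Lemma mvt_closed g (dg : R -> R) a b : a < b ->
  (forall t : R, a <= t <= b -> is_derive t 1 g (dg t)) ->
  exists c, a < c < b /\ g b - g a = dg c * (b - a).
Proof.
move=> ab dgP; have [||c cab e] := @MVT R g dg a b ab.
- by move=> t; rewrite in_itv /= => /andP[h1 h2]; apply: dgP; rewrite !ltW.
- apply: derivable_within_continuous => t; rewrite in_itv /= => tab.
  by have [] := dgP t tab.
- by exists c; move: cab; rewrite in_itv.
Qed.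

Lemma convex_chord g (g1 g2 : R -> R) a b :
  (forall t, a <= t <= b -> is_derive t 1 g (g1 t)) ->
  (forall t, a <= t <= b -> is_derive t 1 g1 (g2 t)) ->
  (forall t, a <= t <= b -> 0 <= g2 t) ->
  forall m, a < m < b -> (g m - g a) * (b - m) <= (g b - g m) * (m - a).
Proof.
move=> d1 d2 g20 m /andP[am mb].
have [|x [/andP[ax xm] ->]] := mvt_closed g g1 a m am.
  by move=> t /andP[h1 h2]; apply: d1; rewrite h1 (le_trans h2) // ltW.
have [|y [/andP[my yb] ->]] := mvt_closed g g1 m b mb.
  by move=> t /andP[h1 h2]; apply: d1; rewrite h2 andbT (le_trans _ h1) // ltW.
have xy : x < y by apply: lt_trans my.
have [|z [/andP[xz zy] gz]] := mvt_closed g1 g2 x y xy.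
  by move=> t /andP[h1 h2]; apply: d2; lra.
have : g1 x <= g1 y.
  rewrite -subr_ge0 gz; apply: mulr_ge0; last by rewrite subr_ge0 ltW.
  by apply: g20; lra.
move=> h; rewrite mulrAC; apply: ler_wpM2r; first by rewrite subr_ge0 ltW.
by apply: ler_wpM2r => //; rewrite subr_ge0 ltW.
Qed.

Lemma convex_le_max g (g1 g2 : R -> R) a b M :
  (forall t, a <= t <= b -> is_derive t 1 g (g1 t)) ->
  (forall t, a <= t <= b -> is_derive t 1 g1 (g2 t)) ->
  (forall t, a <= t <= b -> 0 <= g2 t) ->
  g a <= M -> g b <= M -> forall t, a <= t <= b -> g t <= M.
Proof.
move=> d1 d2 g20 ga gb t /andP[]; rewrite le_eqVlt => /predU1P[<-//|at_].
rewrite le_eqVlt => /predU1P[->//|tb].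
rewrite leNgt; apply/negP => Mt.
have := convex_chord g g1 g2 a b d1 d2 g20 t; rewrite at_ tb => /(_ isT).
apply/negP; rewrite -ltNge (@lt_trans _ _ 0) //.
  by rewrite nmulr_rlt0 ?subr_gt0 // subr_lt0 (le_lt_trans gb).
by rewrite mulr_gt0 ?subr_gt0 // (le_lt_trans ga).
Qed.

(** Where [e] is positive, 1 / sqrt e has derivative - e' / (2 e sqrt e), hence is [B]-Lipschitz.
    Adding [eta] avoids division by 0 should [e] vanish. *)
Lemma speed_lower_bound (e e1 : R -> R) (B T : R) : 0 < B -> 0 < T ->
  (forall t, 0 <= t <= T -> is_derive t 1 e (e1 t)) ->
  (forall t, 0 <= t <= T -> 0 <= e t) ->
  (forall t, 0 <= t <= T -> `|e1 t| <= 2 * B * (e t * Num.sqrt (e t))) ->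
  0 < e 0 -> ((Num.sqrt (e 0))^-1 + B * T)^-1 ^+ 2 <= e T.
Proof.
move=> B0 T0 de e_ge0 e1le e00.
apply/ler_addgt0Pr => eta eta0.
pose phi t := (Num.sqrt (e t + eta))^-1.
have pos t : 0 <= t <= T -> 0 < e t + eta by move=> h; rewrite ltr_wpDl // e_ge0.
have spos t : 0 <= t <= T -> 0 < Num.sqrt (e t + eta) by move=> h; rewrite sqrtr_gt0 pos.
have dphi t : 0 <= t <= T -> is_derive t 1 phi
    (- (Num.sqrt (e t + eta)) ^- 2 *: ((2 * Num.sqrt (e t + eta))^-1 * e1 t)).
  move=> h; apply: is_deriveV; first by rewrite gt_eqF // spos.
  have d1 : is_derive t 1 (fun t => e t + eta) (e1 t).
    rewrite -[e1 t]addr0; apply: is_deriveD; first exact: de.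
  apply: (@is_derive1_comp R Num.sqrt (fun t => e t + eta)).
  by apply: is_derive1_sqrt; exact: pos.
have [c [/andP[c0 cT] pc]] := mvt_closed phi _ 0 T T0 dphi.
have ch : 0 <= c <= T by rewrite !ltW.
have phiT : phi T <= phi 0 + B * T.
  rewrite -lerBlDl pc subr0 ler_wpM2r //; first exact: ltW.
  set s := Num.sqrt (e c + eta); have s0 : 0 < s by exact: spos.
  have s2 : s ^+ 2 = e c + eta by rewrite sqr_sqrtr // ltW // pos.
  apply: le_trans (ler_norm _) _.
  rewrite normrZ normrN normrM !normfV (gtr0_norm (exprn_gt0 2 s0)).
  rewrite (@gtr0_norm _ (2 * s)) ?mulr_gt0 //.
  have e1s : `|e1 c| <= 2 * B * (s ^+ 2 * s).
    apply: le_trans (e1le c ch) _; rewrite ler_wpM2l ?mulr_ge0 ?(ltW B0) //.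
    rewrite s2; apply: ler_pM.
    - exact: e_ge0.
    - exact: sqrtr_ge0.
    - by rewrite lerDl ltW.
    - by apply: ler_wsqrtr; rewrite lerDl ltW.
  rewrite mulrA -invfM mulrC ler_pdivrMr ?mulr_gt0 ?exprn_gt0 //.
  by apply: le_trans e1s _; rewrite le_eqVlt; apply/orP; left; apply/eqP; ring.
have phi0 : phi 0 <= (Num.sqrt (e 0))^-1.
  have h0 : (0 : R) <= 0 <= T by apply/andP; split=> //; exact: ltW.
  rewrite lef_pV2 ?posrE ?sqrtr_gt0 ?pos //.
  by apply: ler_wsqrtr; rewrite lerDl ltW.
have hT : 0 <= T <= T by apply/andP; split=> //; exact: ltW.
have sT := spos T hT.
have D0 : 0 < (Num.sqrt (e 0))^-1 + B * T by rewrite addr_gt0 ?mulr_gt0 ?invr_gt0 ?sqrtr_gt0.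
have : ((Num.sqrt (e 0))^-1 + B * T)^-1 <= Num.sqrt (e T + eta).
  rewrite -[leRHS]invrK lef_pV2 ?posrE ?invr_gt0 //.
  by apply: le_trans phiT _; rewrite lerD2r.
move=> h0; apply: (@le_trans _ _ (Num.sqrt (e T + eta) ^+ 2)).
  by rewrite lerXn2r ?nnegrE ?sqrtr_ge0 // invr_ge0 ltW.
by rewrite sqr_sqrtr // ltW // pos.
Qed.

(** Obtained by solving for [e 0] the midpoint convexity inequality at 0, 1/4, 1/2 in
    [speed_bound_start]; the 1 covers small speeds. *)
Definition speed_bound (c1 B W : R) : R :=
  Num.max 1 (expR (ln (1 + B / 2) + 2 * W / (c1 / B ^+ 2) - 2 * ln (B / 4)) ^+ 2).

(* Comparison of [w] with [- (c1 / B ^ 2) ln (1 / sqrt (e 0) + B t)], whose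
   convexity is concentrated at 0 when [e 0] is large. *)
Lemma speed_bound_start (e e1 w w1 w2 : R -> R) (c1 B W : R) :
  0 < c1 -> 0 < B ->
  (forall t, 0 <= t <= 2^-1 -> is_derive t 1 e (e1 t)) ->
  (forall t, 0 <= t <= 2^-1 -> 0 <= e t) ->
  (forall t, 0 <= t <= 2^-1 -> `|e1 t| <= 2 * B * (e t * Num.sqrt (e t))) ->
  (forall t, 0 <= t <= 2^-1 -> is_derive t 1 w (w1 t)) ->
  (forall t, 0 <= t <= 2^-1 -> is_derive t 1 w1 (w2 t)) ->
  (forall t, 0 <= t <= 2^-1 -> c1 * e t <= w2 t) ->
  (forall t, 0 <= t <= 2^-1 -> 0 <= w t <= W) ->
  e 0 <= speed_bound c1 B W.
Proof.
move=> c10 B0 de e_ge0 e1le dw dw1 w2ge wW.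
rewrite /speed_bound le_max; case: (leP (e 0) 1) => //= e01.
have e00 : 0 < e 0 by apply: lt_trans e01.
pose eps := (Num.sqrt (e 0))^-1.
have s0 : 0 < Num.sqrt (e 0) by rewrite sqrtr_gt0.
have eps0 : 0 < eps by rewrite invr_gt0.
have eps1 : eps <= 1.
  by rewrite invf_le1 // -sqrtr1 ler_sqrt // ltW.
pose kap := c1 / B ^+ 2.
have B20 : 0 < B ^+ 2 by rewrite exprn_gt0.
have kap0 : 0 < kap by rewrite divr_gt0.
have Dp t : 0 <= t -> 0 < eps + B * t by move=> t0; rewrite ltr_wpDr // mulr_ge0 // ltW.
pose z t := w t + kap * ln (eps + B * t).
pose z1 t := w1 t + kap * ((eps + B * t)^-1 * B).
pose z2 t := w2 t + kap * (- (eps + B * t) ^- 2 * B * B).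
have dlin t : is_derive t 1 (fun t => eps + B * t) B by exact: is_derive_affine_id.
have dz t : 0 <= t <= 2^-1 -> is_derive t 1 z (z1 t).
  move=> h; apply: is_deriveD; first exact: dw.
  apply: (is_deriveZ kap).
  apply: (@is_derive1_comp R (@ln R) (fun t => eps + B * t)).
  by apply: is_derive1_ln; apply: Dp; case/andP: h.
have dz1 t : 0 <= t <= 2^-1 -> is_derive t 1 z1 (z2 t).
  move=> h; apply: is_deriveD; first exact: dw1.
  apply: (is_deriveZ kap).
  have d1 : is_derive t 1 (fun t => (eps + B * t)^-1) (- (eps + B * t) ^- 2 *: B).
    by apply: is_deriveV => //; rewrite gt_eqF // Dp //; case/andP: h.
  apply: is_derive_eq (is_deriveM d1 (is_derive_cst B t 1)) _.
  by rewrite scaler0 add0r [LHS]mulrC.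
(* By [speed_lower_bound], [w2 t] is at least [c1 * (eps + B * t) ^- 2]; [kap] is chosen so that the
   second derivative of the logarithmic term cancels exactly this. *)
have z20 t : 0 <= t <= 2^-1 -> 0 <= z2 t.
  move=> h; rewrite /z2.
  have low : (eps + B * t) ^- 2 <= e t.
    have /andP[t0 t1] := h; move: t0; rewrite le_eqVlt => /predU1P[<-|t0].
      by rewrite mulr0 addr0 /eps exprVn invrK sqr_sqrtr // ltW.
    rewrite -exprVn; apply: (speed_lower_bound e e1) => // s /andP[s1 s2].
    - by apply: de; rewrite s1 (le_trans s2).
    - by apply: e_ge0; rewrite s1 (le_trans s2).
    - by apply: e1le; rewrite s1 (le_trans s2).
  have : c1 * (eps + B * t) ^- 2 <= w2 t.
    by apply: le_trans (w2ge t h); rewrite ler_wpM2l // ltW.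
  have -> : kap * (- (eps + B * t) ^- 2 * B * B) = - (c1 * (eps + B * t) ^- 2).
    rewrite /kap; move: ((eps + B * t) ^- 2) => X.
    by field; rewrite gt_eqF.
  by rewrite subr_ge0.
(* In this inequality [ln eps] tends to minus infinity as [e 0] grows, while the other terms stay
   bounded: those with [w] cost at most [2 * W], and the two other logarithms are controlled by
   [0 < eps <= 1]. *)
have mid : 0 < (4^-1 : R) < 2^-1 by lra.
have := convex_chord z z1 z2 0 2^-1 dz dz1 z20 _ mid.
have -> : (2^-1 - 4^-1 : R) = 4^-1 by lra.
rewrite subr0 ler_pM2r; last by lra.
rewrite /z mulr0 addr0 => chord.
have w0 : 0 <= w 0 <= W by apply: wW; lra.
have wm : 0 <= w 4^-1 <= W by apply: wW; lra.
have wb : 0 <= w 2^-1 <= W by apply: wW; lra.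
have l1 : ln (B / 4) <= ln (eps + B * 4^-1).
  by rewrite ler_ln ?posrE; [rewrite lerDr ltW|rewrite divr_gt0|apply: Dp; lra].
have l2 : ln (eps + B * 2^-1) <= ln (1 + B / 2).
  by rewrite ler_ln ?posrE; [rewrite lerD2r|apply: Dp; lra|rewrite addr_gt0 // divr_gt0].
have key : kap * (2 * ln (B / 4)) <= 2 * W + kap * (ln eps + ln (1 + B / 2)).
  have h1 : kap * ln (B / 4) <= kap * ln (eps + B * 4^-1) by rewrite ler_pM2l.
  have h2 : kap * ln (eps + B * 2^-1) <= kap * ln (1 + B / 2) by rewrite ler_pM2l.
  move: h1 h2 chord w0 wm wb.
  set X1 := kap * ln (eps + B * 4^-1); set X2 := kap * ln (eps + B * 2^-1).
  set X3 := kap * ln eps.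
  rewrite [kap * (2 * _)]mulrCA mulrDr -/X3.
  set X4 := kap * ln (B / 4); set X5 := kap * ln (1 + B / 2).
  lra.
have lneps : - ln eps <= ln (1 + B / 2) + 2 * W / kap - 2 * ln (B / 4).
  have : 2 * ln (B / 4) <= 2 * W / kap + (ln eps + ln (1 + B / 2)).
    rewrite -(@ler_pM2l _ kap) // [leRHS]mulrDr [kap * (2 * W / kap)]mulrC divfK //.
    by rewrite gt_eqF.
  set X := 2 * W / kap; lra.
rewrite -[leLHS]sqr_sqrtr ?(ltW e00) // lerXn2r ?nnegrE ?sqrtr_ge0 ?expR_ge0 //.
rewrite -[leLHS]lnK ?posrE // ler_expR.
by move: lneps; rewrite {1}/eps lnV ?posrE // opprK.
Qed.

Lemma is_derive_affine (g : R -> R) (d t0 s t : R) :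
  is_derive (t0 + s * t) 1 g d -> is_derive t 1 (fun t => g (t0 + s * t)) (s * d).
Proof.
move=> dg; rewrite mulrC; apply: (@is_derive1_comp R g (fun t => t0 + s * t)).
exact: is_derive_affine_id.
Qed.

(** From any time of [1, 2] an interval of length 1/2 stays inside when run forwards or backwards;
    [s] is the sign of that direction. *)
Lemma speed_bound_segment (e e1 w w1 w2 : R -> R) (c1 B W : R) :
  0 < c1 -> 0 < B ->
  (forall t, 1 <= t <= 2 -> is_derive t 1 e (e1 t)) ->
  (forall t, 1 <= t <= 2 -> 0 <= e t) ->
  (forall t, 1 <= t <= 2 -> `|e1 t| <= 2 * B * (e t * Num.sqrt (e t))) ->
  (forall t, 1 <= t <= 2 -> is_derive t 1 w (w1 t)) ->
  (forall t, 1 <= t <= 2 -> is_derive t 1 w1 (w2 t)) ->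
  (forall t, 1 <= t <= 2 -> c1 * e t <= w2 t) ->
  (forall t, 1 <= t <= 2 -> 0 <= w t <= W) ->
  forall t, 1 <= t <= 2 -> e t <= speed_bound c1 B W.
Proof.
move=> c10 B0 de e_ge0 e1le dw dw1 w2ge wW t0 t012.
have [s [s2 sin]] : exists s : R, s * s = 1 /\
    forall t, 0 <= t <= 2^-1 -> 1 <= t0 + s * t <= 2.
  case: (leP t0 (3 / 2)) => h; [exists 1|exists (-1)]; split; try lra.
    by move=> t; lra.
  by move=> t; lra.
have -> : e t0 = e (t0 + s * 0) by rewrite mulr0 addr0.
apply: (@speed_bound_start (fun t => e (t0 + s * t)) (fun t => s * e1 (t0 + s * t))
  (fun t => w (t0 + s * t)) (fun t => s * w1 (t0 + s * t)) (fun t => w2 (t0 + s * t))) => //.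
- by move=> t /sin h; apply: is_derive_affine; exact: de.
- by move=> t /sin; exact: e_ge0.
- move=> t /sin h; rewrite normrM.
  have -> : `|s| = 1.
    apply/eqP; rewrite -(@eqrXn2 _ 2) // expr1n real_normK ?num_real // expr2 s2.
    exact: eqxx.
  by rewrite mul1r; exact: e1le.
- by move=> t /sin h; apply: is_derive_affine; exact: dw.
- move=> t /sin h; rewrite (_ : w2 _ = s * (s * w2 (t0 + s * t))); last first.
    by rewrite mulrA s2 mul1r.
  apply: (is_deriveZ s).
  by apply: is_derive_affine; exact: dw1.
- by move=> t /sin; exact: w2ge.
- by move=> t /sin; exact: wW.
Qed.

End SpeedBound.

(** * Geometry of graphs in Minkowski space *)

Section LorentzianForm.
Context {R : realType}.
Variable n : nat.
Local Notation eta := (@minkowski_mx R n).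

Lemma minkowski_mxK : eta *m eta = 1%:M.
Proof.
rewrite mulmx_diag -diag_const_mx; congr diag_mx; apply/rowP => i.
by rewrite !mxE; case: ifP => _; rewrite ?mulrNN mulr1.
Qed.

Lemma minkowski_mx_tr : eta^T = eta. Proof. exact: tr_diag_mx. Qed.

Lemma minkowski_mx_unit : eta \in unitmx.
Proof. by have [] := mulmx1_unit minkowski_mxK. Qed.

(** On the column of partial derivatives of a function this is <grad u, grad u>: [eta] is its own
    inverse, so it also gives the form on covectors. *)
Definition mnorm (w : 'cV[R]_n) : R := (w^T *m eta *m w) 0 0.

Lemma mnormE w : w^T *m eta *m w = (mnorm w)%:M.
Proof. exact: mx11_scalar. Qed.

Lemma mul_mnorm m (X : 'M[R]_(m, 1)) w : X *m w^T *m eta *m w = mnorm w *: X.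
Proof. by rewrite -!mulmxA [w^T *m _]mulmxA mnormE mul_mx_scalar. Qed.

Lemma mnormZ a w : mnorm (a *: w) = a ^+ 2 * mnorm w.
Proof. by rewrite /mnorm [(a *: w)^T]linearZ /= -!scalemxAl -scalemxAr scalerA mxE expr2. Qed.

Lemma lorentzian_form_unit (G : 'M[R]_n) : lorentzian_form G -> G \in unitmx.
Proof.
move=> [P _ PG]; have := minkowski_mx_unit; rewrite -PG !unitmx_mul.
by case/andP=> /andP[].
Qed.

Lemma lorentzian_form_congr (A G : 'M[R]_n) : A \in unitmx ->
  lorentzian_form G -> lorentzian_form (A *m G *m A^T).
Proof.
move=> uA [P uP PG]; exists (P *m invmx A); first by rewrite unitmx_mul uP unitmx_inv.
rewrite trmx_mul trmx_inv !mulmxA -(mulmxA _ A^T) mulmxV ?unitmx_tr // mulmx1.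
by rewrite -(mulmxA P) mulVmx // mulmx1.
Qed.

(* [P = 1 + c w w^T eta] with [c = - 1 / (r (r + 1))], [r ^ 2 = 1 + mnorm w], is
   the solution of [P (eta + w w^T) P^T = eta] in [1 + R w w^T eta]. *)
Lemma lorentzian_form_add (w : 'cV[R]_n) : -1 < mnorm w ->
  lorentzian_form (eta + w *m w^T).
Proof.
move=> N1; set N := mnorm w in N1.
pose r := Num.sqrt (1 + N).
have N0 : 0 < 1 + N by rewrite -ltrBlDl sub0r.
have r0 : 0 < r by rewrite sqrtr_gt0.
have r2 : r ^+ 2 = 1 + N by rewrite sqr_sqrtr // ltW.
have NE : N = r ^+ 2 - 1 by rewrite r2; ring.
pose A : 'M[R]_n := w *m w^T *m eta.
have AA : A *m A = N *: A.
  by rewrite /A !mulmxA mul_mnorm -!scalemxAl.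
have unitP c d : c + d + c * d * N = 0 -> (1%:M + c *: A) *m (1%:M + d *: A) = 1%:M.
  move=> cd; rewrite mulmxDl mul1mx mulmxDr mulmx1 -scalemxAl -scalemxAr AA !scalerA.
  rewrite -addrA -[RHS]addr0; congr (_ + _).
  by rewrite -!scalerDl -[RHS](scale0r A) -cd; congr (_ *: _); ring.
pose c := - (r * (r + 1))^-1.
have r1 : r + 1 != 0 by rewrite gt_eqF // addr_gt0.
have rn0 : r != 0 by rewrite gt_eqF.
exists (1%:M + c *: A).
  have cd : c + - c * r + c * (- c * r) * N = 0.
    by rewrite NE /c; field; rewrite rn0 r1.
  by have [] := mulmx1_unit (unitP c (- c * r) cd).
have Aw : A *m w = N *: w by rewrite /A mul_mnorm.
have AT : A^T = eta *m w *m w^T.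
  by rewrite /A !trmx_mul trmxK minkowski_mx_tr mulmxA.
have Pw : (1%:M + c *: A) *m w = (1 + c * N) *: w.
  by rewrite mulmxDl mul1mx -scalemxAl Aw scalerA scalerDl scale1r.
have wP : w^T *m (1%:M + c *: A)^T = (1 + c * N) *: w^T.
  by rewrite -trmx_mul Pw linearZ.
rewrite mulmxDr mulmxDl mulmxA Pw -!(mulmxA _ w^T) wP -scalemxAl -scalemxAr scalerA.
have -> : (1%:M + c *: A) *m eta *m (1%:M + c *: A)^T =
    eta + (2 * c + c ^+ 2 * N) *: (w *m w^T).
  have Ae : A *m eta = w *m w^T by rewrite /A -mulmxA minkowski_mxK mulmx1.
  rewrite mulmxDl mul1mx -scalemxAl Ae linearD /= trmx1 linearZ /=.
  rewrite mulmxDr mulmx1 mulmxDl -!scalemxAr -!scalemxAl.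
  have -> : eta *m A^T = w *m w^T by rewrite AT !mulmxA minkowski_mxK mul1mx.
  have -> : w *m w^T *m A^T = N *: (w *m w^T).
    by rewrite AT !mulmxA mul_mnorm -!scalemxAl.
  rewrite -addrA; congr (_ + _); rewrite !scalerA -!scalerDl; congr (_ *: _); ring.
rewrite -addrA -scalerDl -[RHS]addr0; congr (_ + _).
rewrite -[RHS](scale0r (w *m w^T)); congr (_ *: _).
by rewrite NE /c; field; rewrite rn0 r1.
Qed.

Lemma det_minkowski : (0 < n)%N -> \det eta = -1.
Proof.
move=> n0; rewrite det_diag (bigD1 (Ordinal n0)) //= !mxE eqxx.
rewrite big1 ?mulr1 // => i /negPf i0; rewrite mxE.
by case: eqP => // /eqP e; move: i0; rewrite -val_eqE /= e.
Qed.

(** The matrix determinant lemma, read off from a product with unipotent block triangular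
    factors. *)
Lemma det_rank1_add (w : 'cV[R]_n) : \det (eta + w *m w^T) = \det eta * (1 + mnorm w).
Proof.
have e1 : eta + w *m w^T = eta *m (1%:M + (eta *m w) *m w^T).
  by rewrite mulmxDr mulmx1 !mulmxA minkowski_mxK mul1mx.
rewrite e1 det_mulmx; congr (_ * _).
pose b := eta *m w.
have h1 : block_mx 1%:M (- b) 0 1%:M *m block_mx (1%:M + b *m w^T) 0 w^T 1%:M *m
   block_mx 1%:M b 0 1%:M = block_mx 1%:M 0 w^T (1%:M + w^T *m b) :> 'M[R]_(n + 1).
  rewrite !mulmx_block !(mul0mx, mulmx0, mul1mx, mulmx1, add0r, addr0) mulNmx.
  rewrite addrK mul1mx subrr [w^T *m b + _]addrC.
  by congr block_mx.
have := congr1 determinant h1.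
rewrite !det_mulmx !(det_ublock, det_lblock) !det1 !mul1r !mulr1 => ->.
rewrite [X in \det X]mx11_scalar det_scalar1 !mxE eqxx; congr (_ + _).
by rewrite /mnorm -mulmxA !mxE.
Qed.

(** A congruence multiplies the determinant by a positive square; here it takes [- (1 + mnorm w)] to
    -1. *)
Lemma lorentzian_form_mnorm (w : 'cV[R]_n) : (0 < n)%N ->
  lorentzian_form (eta + w *m w^T) -> -1 < mnorm w.
Proof.
move=> n0 [P uP PG]; have := congr1 determinant PG.
rewrite !det_mulmx det_tr det_rank1_add det_minkowski // => h.
have dP : \det P != 0 by rewrite -unitfE -unitmxE.
have d2 : 0 < \det P ^+ 2 by rewrite exprn_even_gt0.
have : \det P ^+ 2 * (1 + mnorm w) = 1.
  by rewrite -[RHS]opprK -h; ring.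
move=> e; have : 0 < 1 + mnorm w by rewrite -(pmulr_rgt0 _ d2) e.
lra.
Qed.

End LorentzianForm.

Section GraphGeometry.
Context {R : realType}.
Variable n : nat.
Hypothesis n_gt0 : (0 < n)%N.
Implicit Types u : 'rV[R]_n -> R.

Definition graph_map u (x : 'rV[R]_n) : 'rV[R]_(n + 1) := row_mx x (u x)%:M.
(** The differential, with index not raised; the factor [minkowski_mx n] in [geodesic_accel] raises
    it. *)
Definition grad u (x : 'rV[R]_n) : 'cV[R]_n := \col_i 'D_(coord_vec i) u x.

Lemma Ck_on_id (V : normedModType R) k (U : set V) : Ck_on k U id.
Proof. by apply: (@Ck_on_linear R V V k U idfun) => x; exact: cvg_id. Qed.

Lemma smooth_graph_map u : smooth_on setT u -> smooth_on setT (graph_map u).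
Proof.
move=> su k; apply: Ck_on_rV => [|i]; first exact: openT.
under eq_fun do rewrite mxE.
case: (fintype.split i) => j.
  by apply: (@Ck_on_coord _ _ k setT n id); [exact: openT|exact: Ck_on_id].
by under eq_fun do rewrite mxE ord1 eqxx mulr1n; exact: su.
Qed.

Lemma smooth_differentiable (V W : normedModType R) (U : set V) (f : V -> W) x :
  smooth_on U f -> U x -> differentiable f x.
Proof. by move=> /(_ 1%N)[df _]; exact: df. Qed.

Lemma jacobian_graph_map u x : smooth_on setT u ->
  'J (graph_map u) x = row_mx 1%:M (grad u x).
Proof.
move=> su; apply/row_matrixP => i.
have du := smooth_differentiable _ _ _ _ x su I.
have dg := smooth_differentiable _ _ _ _ x (smooth_graph_map u su) I.
rewrite rowE -deriveEjacobian // row_row_mx row1.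
apply/rowP => j; rewrite -derive_coord //.
under eq_fun do rewrite mxE.
rewrite [RHS]mxE; case: (fintype.split j) => k.
  by rewrite (@derive_coord _ _ n id) // derive_id.
by under eq_fun do rewrite mxE ord1 eqxx mulr1n; rewrite !mxE.
Qed.

Lemma minkowski_mxS :
  @minkowski_mx R (n + 1) = block_mx (minkowski_mx n) 0 0 1%:M.
Proof.
apply/matrixP => i j.
case: (fintype.split_ordP i) => i' ->; case: (fintype.split_ordP j) => j' ->.
- by rewrite block_mxEul !mxE eq_lshift.
- by rewrite block_mxEur !mxE eq_lrshift.
- by rewrite block_mxEdl !mxE eq_rlshift.
(* The last index is [n]; it differs from the negative index 0 because [n] is positive. *)
- rewrite block_mxEdr !mxE eq_rshift !ord1 /= addn0.
  by rewrite -[n == 0%N]negbK -lt0n n_gt0.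
Qed.

Lemma induced_metric_graph_map u x : smooth_on setT u ->
  induced_metric (graph_map u) x = minkowski_mx n + grad u x *m (grad u x)^T.
Proof.
move=> su; rewrite /induced_metric jacobian_graph_map // minkowski_mxS.
rewrite mul_row_block !mul1mx !mulmx0 mulmx1 addr0 add0r tr_row_mx mul_row_col.
by rewrite trmx1 mulmx1.
Qed.

Lemma local_param_graph_map u : smooth_on setT u ->
  local_param (graph u) setT (graph_map u).
Proof.
move=> su; split.
- exact: openT.
- exact: smooth_graph_map.
- move=> x _; rewrite jacobian_graph_map //; apply/row_freeP.
  by exists (col_mx 1%:M 0); rewrite mul_row_col mulmx1 mulmx0 addr0.
- by move=> x y _ _ /(congr1 lsubmx); rewrite !row_mxKl.
- move=> V oV _; exists (lsubmx @^-1` V).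
    by apply: open_comp => // x _; exact: lsubmx_continuous.
  apply/seteqP; split=> [_ [x Vx <-]|_ [[x _ <-]]] /=.
    by split; [exists x|rewrite /= row_mxKl].
  by rewrite row_mxKl => Vx; exists x.
Qed.

(** The metric must be Lorentzian in every local parametrization [phi]. Each is [graph_map u] after
    its projection [psi], whose Jacobian is invertible since that of [phi] has full rank; the two
    metrics are thus congruent. *)
Lemma timelike_graph u : smooth_on setT u -> (forall x, -1 < mnorm n (grad u x)) ->
  timelike_hypersurface (graph u).
Proof.
move=> su N1; split.
  move=> p [x _ <-]; exists setT, (graph_map u); split; last by exists x.
  exact: local_param_graph_map.
move=> U phi [oU sphi rphi _ hphi] x Ux.
pose psi y := lsubmx (phi y).
have phiE y : U y -> phi y = graph_map u (psi y).
  move=> Uy; have [W _ WE] := hphi U oU (@subset_refl _ U).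
  have : (phi @` U) (phi y) by exists y.
  rewrite WE => -[[z _ zE] _].
  by rewrite /psi -zE row_mxKl.
have dphi := smooth_differentiable _ _ _ _ x sphi Ux.
have dpsi : differentiable psi x.
  apply: differentiable_rV => i; under eq_fun do rewrite mxE.
  apply: (@differentiable_comp _ _ _ _ phi (fun v : 'rV[R]_(n + 1) => v 0 (lshift 1 i))) => //.
  exact: differentiable_coord.
have dgr := smooth_differentiable _ _ _ _ (psi x) (smooth_graph_map u su) I.
have JE : 'J phi x = 'J psi x *m 'J (graph_map u) (psi x).
  apply/row_matrixP => i; rewrite !rowE mulmxA -!deriveEjacobian //.
  transitivity ('D_(delta_mx 0 i) (graph_map u \o psi) x).
    apply: near_eq_derive.
    have : nbhs x U by exact: open_nbhs_nbhs.
    by apply: filterS => y; exact: phiE.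
  rewrite deriveE; last exact: differentiable_comp.
  by rewrite diff_comp //= deriveE // deriveE.
have uJ : 'J psi x \in unitmx.
  have /row_freeP[B] := rphi x Ux; rewrite JE -mulmxA => h.
  by have [] := mulmx1_unit h.
have -> : induced_metric phi x =
   'J psi x *m induced_metric (graph_map u) (psi x) *m ('J psi x)^T.
  by rewrite /induced_metric JE trmx_mul !mulmxA.
apply: lorentzian_form_congr => //; rewrite induced_metric_graph_map //.
exact: lorentzian_form_add.
Qed.

Lemma timelike_graph_mnorm u x : smooth_on setT u ->
  timelike_hypersurface (graph u) -> -1 < mnorm n (grad u x).
Proof.
move=> su [_ /(_ _ _ (local_param_graph_map u su) x I)].
by rewrite induced_metric_graph_map //; exact: lorentzian_form_mnorm.
Qed.

Definition geodesic_accel u (x v : 'rV[R]_n) : 'rV[R]_n :=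
  - ((v *m hessian u x *m v^T) 0 0 / (1 + mnorm n (grad u x)))
    *: ((grad u x)^T *m minkowski_mx n).

Lemma quad_formE (H : 'M[R]_n) (v : 'rV[R]_n) :
  (v *m H *m v^T) 0 0 = \sum_i \sum_j H i j * v 0 i * v 0 j.
Proof.
rewrite mxE exchange_big /=; apply: eq_bigr => j _.
by rewrite !mxE mulr_suml; apply: eq_bigr => i _; rewrite [v 0 i * _]mulrC.
Qed.

(** With g = eta + du du^T and a symmetric Hessian H, the three derivatives of g combine to 2 H_ij
    u_l, so Gamma^k_ij = (g^-1 du)^k H_ij. Moreover g^-1 du = eta du / (1 + N), because g maps eta
    du to (1 + N) du. *)
Lemma geodesic_equation_graph u (c : R -> 'rV[R]_n) t (v : 'rV[R]_n) :
  smooth_on setT u -> -1 < mnorm n (grad u (c t)) -> derive1 c t = v ->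
  derive1n 2 c t = geodesic_accel u (c t) v ->
  geodesic_equation (induced_metric (graph_map u)) c t.
Proof.
move=> su N1 c1 c2 k; rewrite c2 c1; set x := c t.
set N := mnorm n (grad u x).
have N0 : 1 + N != 0 by rewrite gt_eqF //; move: N1; rewrite -/x -/N; lra.
pose g := induced_metric (graph_map u).
have gE y : g y = minkowski_mx n + grad u y *m (grad u y)^T.
  exact: induced_metric_graph_map.
pose H i j := hessian u x i j.
have Hsym i j : H i j = H j i.
  by rewrite /H !mxE; exact: derive_symmetric (su 2%N).
have Dg i j l : 'D_(coord_vec i) (fun y => g y j l) x =
    H i j * grad u x l 0 + grad u x j 0 * H i l.
  have -> : (fun y => g y j l) = cst (minkowski_mx n j l) +
      (fun y => 'D_(coord_vec j) u y) * (fun y => 'D_(coord_vec l) u y).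
    by apply/funext => y; rewrite gE !mxE big_ord1 !mxE.
  have dD (w : 'rV[R]_n) : derivable (fun y => 'D_w u y) x (coord_vec i).
    by apply: diff_derivable; have [_ /(_ w)[dw _]] := su 2%N; exact: dw.
  rewrite deriveD; [|exact: derivable_cst|exact: derivableM].
  rewrite derive_cst add0r deriveM // [RHS]addrC [in X in _ = _ + X]mulrC.
  by rewrite /H [grad u x l 0]mxE [grad u x j 0]mxE [hessian u x i j]mxE [hessian u x i l]mxE.
have gu : g x \in unitmx.
  by rewrite gE; apply: lorentzian_form_unit; exact: lorentzian_form_add.
have gig : invmx (g x) *m grad u x = (1 + N)^-1 *: (minkowski_mx n *m grad u x).
  have e : g x *m (minkowski_mx n *m grad u x) = (1 + N) *: grad u x.
    by rewrite gE mulmxDl !mulmxA minkowski_mxK mul1mx mul_mnorm scalerDl scale1r.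
  by rewrite -[X in invmx _ *m X](scalerK N0) -e -scalemxAr mulKmx.
set Q := (v *m hessian u x *m v^T) 0 0.
have QE : Q = \sum_i \sum_j H i j * v 0 i * v 0 j by exact: quad_formE.
have -> : \sum_i \sum_j christoffel g x k i j * v 0 i * v 0 j =
    (invmx (g x) *m grad u x) k 0 * Q.
  have CE i j : christoffel g x k i j = (invmx (g x) *m grad u x) k 0 * H i j.
    rewrite /christoffel mxE mulr_suml mulr_sumr; apply: eq_bigr => l _.
    rewrite !Dg (Hsym j i) (Hsym l i) (Hsym l j).
    by field.
  rewrite QE mulr_sumr; apply: eq_bigr => i _; rewrite mulr_sumr; apply: eq_bigr => j _.
  by rewrite CE !mulrA.
have eT : (grad u x)^T *m minkowski_mx n = (minkowski_mx n *m grad u x)^T.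
  by rewrite trmx_mul minkowski_mx_tr.
rewrite gig /geodesic_accel -/N -/Q eT; set w := _ *m grad u x.
clearbody w; rewrite !mxE.
by field.
Qed.

End GraphGeometry.

(** * Geodesics of the graph *)

Section Accel.
Context {R : realType} (n : nat).
Local Notation V := 'rV[R]_n.

Definition msign (i : 'I_n) : R := if val i == 0%N then -1 else 1.

Lemma mul_tr_minkowski (w : 'cV[R]_n) j : (w^T *m minkowski_mx n) 0 j = w j 0 * msign j.
Proof. by rewrite mul_mx_diag !mxE. Qed.

Lemma mnorm_sum (w : 'cV[R]_n) : mnorm n w = \sum_j w j 0 * msign j * w j 0.
Proof. by rewrite /mnorm mxE; apply: eq_bigr => j _; rewrite mul_tr_minkowski. Qed.

Lemma smooth_derive (W W' : normedModType R) (U : set W) (g : W -> W') w :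
  smooth_on U g -> smooth_on U (fun x => 'D_w g x).
Proof. by move=> sg k; have [_] := sg k.+1; apply. Qed.

Lemma smooth_mnorm_grad (u : V -> R) : smooth_on setT u ->
  smooth_on setT (fun x => mnorm n (grad n u x)).
Proof.
move=> su k; under eq_fun do rewrite mnorm_sum.
apply: Ck_on_sum => [|j]; first exact: openT.
under eq_fun do rewrite mxE.
apply: Ck_onM; [exact: openT| |exact: smooth_derive].
by apply: Ck_onM; [exact: openT|exact: smooth_derive|exact: Ck_on_cst].
Qed.

Lemma smooth_accel_coef (u : V -> R) j : smooth_on setT u ->
  (forall x, -1 < mnorm n (grad n u x)) ->
  smooth_on setT (fun x => - ((1 + mnorm n (grad n u x))^-1
    * ((grad n u x)^T *m minkowski_mx n) 0 j)).
Proof.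
move=> su N1 k; apply: Ck_onN; first exact: openT.
apply: Ck_onM; first exact: openT.
  apply: Ck_onV; first exact: openT.
    by move=> x _; rewrite gt_eqF //; have := N1 x; lra.
  apply: Ck_onD; [exact: openT|exact: Ck_on_cst|exact: smooth_mnorm_grad].
under eq_fun do rewrite mul_tr_minkowski mxE.
by apply: Ck_onM; [exact: openT|exact: smooth_derive|exact: Ck_on_cst].
Qed.

Lemma geodesic_accel_coord (u : V -> R) x v j :
  geodesic_accel n u x v 0 j =
  (v *m hessian u x *m v^T) 0 0 *
  - ((1 + mnorm n (grad n u x))^-1 * ((grad n u x)^T *m minkowski_mx n) 0 j).
Proof.
rewrite /geodesic_accel mxE.
move: (_ *m minkowski_mx n) => w; move: (_ 0 0) => Q; ring.
Qed.

Lemma Ck_geodesic_accel (W : normedModType R) k (U : set W) (u : V -> R) (X Y : W -> V) :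
  open U -> smooth_on setT u -> (forall x, -1 < mnorm n (grad n u x)) ->
  Ck_on k U X -> Ck_on k U Y -> Ck_on k U (fun t => geodesic_accel n u (X t) (Y t)).
Proof.
move=> oU su N1 cX cY; apply: Ck_on_rV => // j.
under eq_fun do rewrite geodesic_accel_coord.
apply: Ck_onM => //; last first.
  apply: (@Ck_on_comp R W k U n setT (fun x => - ((1 + mnorm n (grad n u x))^-1
    * ((grad n u x)^T *m minkowski_mx n) 0 j)) X) => //.
  exact: smooth_accel_coef.
under eq_fun do rewrite quad_formE.
apply: Ck_on_sum => // i; apply: Ck_on_sum => // l.
apply: Ck_onM => //; last exact: Ck_on_coord.
apply: Ck_onM => //; last exact: Ck_on_coord.
under eq_fun do rewrite mxE.
apply: (@Ck_on_comp R W k U n setT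
  (fun x => 'D_(coord_vec i) (fun y => 'D_(coord_vec l) u y) x) X) => //.
by do 2!apply: smooth_derive.
Qed.

(** Bootstrap: if [x] and [v] are C^k, so are their derivatives, which are [v] and the acceleration;
    hence both are C^(k+1). *)
Lemma ode_smooth (I : set R) (u : V -> R) (x v : R -> V) : open I ->
  smooth_on setT u -> (forall x, -1 < mnorm n (grad n u x)) ->
  (forall t, I t -> is_derive t 1 x (v t)) ->
  (forall t, I t -> is_derive t 1 v (geodesic_accel n u (x t) (v t))) ->
  smooth_on I x.
Proof.
move=> oI su N1 dx dv.
(* [Ck_on] asks for derivatives in every direction [w] of the line, which are multiples of the usual
   one. *)
have Dlin (g dg : R -> V) (w : R) t : I t -> is_derive t 1 g (dg t) ->
    w *: dg t = 'D_w g t.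
  move=> It [d1 <-]; have d2 : differentiable g t by exact/derivable1_diffP.
  rewrite !deriveE // -linearZ /=; congr ('d g t _); exact: mulr1.
have scal k (g : R -> V) (w : R) : Ck_on k I g -> Ck_on k I (fun t => w *: g t).
  move=> cg; apply: Ck_on_rV => // i; under eq_fun do rewrite mxE.
  by apply: Ck_onM => //; [exact: Ck_on_cst|exact: Ck_on_coord].
have both k : Ck_on k I x /\ Ck_on k I v.
  elim: k => [|k [cx cv]].
    split=> t It; apply: differentiable_continuous; apply/derivable1_diffP.
      by have [] := dx t It.
    by have [] := dv t It.
  split; split=> [t It|w]; try (apply/derivable1_diffP).
  - by have [] := dx t It.
  - apply: Ck_on_ext (scal k v w cv) => // t It.
    by apply: (Dlin x v) => //; exact: dx.
  - by have [] := dv t It.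
  - have ca := Ck_geodesic_accel _ k I u x v oI su N1 cx cv.
    apply: Ck_on_ext (scal k _ w ca) => // t It.
    by apply: (Dlin v (fun t => geodesic_accel n u (x t) (v t))) => //; exact: dv.
by move=> k; have [] := both k.
Qed.

Lemma is_derive_curve (h : V -> R) (x : R -> V) (t : R) (v : V) :
  differentiable h (x t) -> is_derive t 1 x v -> is_derive t 1 (h \o x) ('D_v h (x t)).
Proof.
move=> dh [dx <-]; have ddx : differentiable x t by exact/derivable1_diffP.
split; first by apply/derivable1_diffP; exact: differentiable_comp.
rewrite deriveE; last exact: differentiable_comp.
by rewrite diff_comp //= deriveE // deriveE.
Qed.

Lemma is_derive_coord (x : R -> V) (t : R) (v : V) i :
  is_derive t 1 x v -> is_derive t 1 (fun t => x t 0 i) (v 0 i).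
Proof.
move=> dx; have := is_derive_curve (fun v : V => v 0 i) x t v.
rewrite (@derive_coord _ _ n id) // derive_id; apply=> //.
exact: differentiable_coord.
Qed.

(** The Euclidean square serves as speed, since the norm of row vectors is the maximum norm, which
    is not differentiable. *)
Definition esq (v : V) : R := \sum_i v 0 i ^+ 2.

Lemma esq_ge0 (v : V) : 0 <= esq v. Proof. by apply: sumr_ge0 => i _; exact: sqr_ge0. Qed.

Lemma coord_le_esq (v : V) i : v 0 i ^+ 2 <= esq v.
Proof. by rewrite /esq (bigD1 i) //= lerDl sumr_ge0 // => j _; exact: sqr_ge0. Qed.

Lemma norm_le_sqrt_esq (v : V) : `|v| <= Num.sqrt (esq v).
Proof.
apply: rV_norm_le; first exact: sqrtr_ge0.
by move=> i; rewrite -sqrtr_sqr ler_wsqrtr // coord_le_esq.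
Qed.

Lemma esq_gt0 (v : V) : v != 0 -> 0 < esq v.
Proof.
move=> v0; rewrite lt_neqAle esq_ge0 andbT eq_sym; apply: contra v0 => /eqP e0.
apply/eqP/rowP => i; rewrite mxE; apply/eqP; rewrite -sqrf_eq0 eq_le sqr_ge0 andbT.
by rewrite -e0 coord_le_esq.
Qed.

Lemma esqZ a (v : V) : esq (a *: v) = a ^+ 2 * esq v.
Proof. by rewrite mulr_sumr; apply: eq_bigr => i _; rewrite mxE exprMn. Qed.

Lemma is_derive_esq (v : R -> V) (t : R) (g : V) : is_derive t 1 v g ->
  is_derive t 1 (fun t => esq (v t)) (\sum_i 2 * (v t 0 i * g 0 i)).
Proof.
move=> dv; have := @is_derive_sum R R R n (fun i t => v t 0 i ^+ 2) t 1
  (fun i => 2 * (v t 0 i * g 0 i)).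
have -> : (\sum_(i < n) (fun t => v t 0 i ^+ 2)) = fun t => esq (v t).
  by apply/funext => z; rewrite fct_sumE.
apply=> i; have d := is_derive_coord _ _ _ i dv.
apply: is_derive_eq (is_deriveX 2 d) _.
by rewrite expr1 mulrA.
Qed.

(** Turns a quadratic bound on the acceleration into the differential inequality required by
    [speed_lower_bound]. *)
Lemma norm_derive_esq (v g : V) B0 : `|g| <= B0 * esq v ->
  `|\sum_i 2 * (v 0 i * g 0 i)| <= 2 * (n%:R * B0) * (esq v * Num.sqrt (esq v)).
Proof.
move=> gB; apply: le_trans (ler_norm_sum _ _ _) _.
apply: (@le_trans _ _ (\sum_(i < n) 2 * (Num.sqrt (esq v) * (B0 * esq v)))).
  apply: ler_sum => i _; rewrite !normrM ger0_norm // ler_wpM2l //.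
  apply: ler_pM => //.
    exact: le_trans (coord_le_norm _ _ _) (norm_le_sqrt_esq v).
  exact: le_trans (coord_le_norm _ _ _) gB.
by rewrite sumr_const card_ord -[leLHS]mulr_natl le_eqVlt; apply/orP; left; apply/eqP; ring.
Qed.

Lemma compact_continuous_bound (T : topologicalType) (K : set T) (g : T -> R) :
  compact K -> continuous g -> exists2 M, 0 < M & forall x, K x -> `|g x| <= M.
Proof.
move=> cK cg; have : bounded_set (g @` K).
  by apply: compact_bounded; apply: continuous_compact => //; exact: continuous_subspaceT.
move=> /ex_strict_bound_gt0[M M0 hM]; exists M => // x Kx.
by apply/ltW/hM; exists x.
Qed.

Lemma smooth_continuous (W W' : normedModType R) (g : W -> W') :
  smooth_on setT g -> continuous g.
Proof. by move=> sg x; exact: (sg 0%N x I). Qed.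

Lemma quad_bound (H : 'M[R]_n) (v : V) :
  `|(v *m H *m v^T) 0 0| <= (\sum_i \sum_j `|H i j|) * esq v.
Proof.
rewrite quad_formE mulr_suml; apply: le_trans (ler_norm_sum _ _ _) _.
apply: ler_sum => i _; rewrite mulr_suml; apply: le_trans (ler_norm_sum _ _ _) _.
apply: ler_sum => j _; rewrite -mulrA normrM ler_wpM2l // normrM.
apply: (@le_trans _ _ (Num.sqrt (esq v) * Num.sqrt (esq v))).
  by apply: ler_pM => //; exact: le_trans (coord_le_norm _ _ _) (norm_le_sqrt_esq v).
by rewrite -expr2 sqr_sqrtr // esq_ge0.
Qed.

Lemma geodesic_accel_bound (u : V -> R) (K : set V) : compact K ->
  smooth_on setT u -> (forall x, -1 < mnorm n (grad n u x)) ->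
  exists2 B, 0 < B & forall x v, K x -> `|geodesic_accel n u x v| <= B * esq v.
Proof.
move=> cK su N1.
pose C j x := - ((1 + mnorm n (grad n u x))^-1 * ((grad n u x)^T *m minkowski_mx n) 0 j).
have sC j : continuous (C j) by apply: smooth_continuous; exact: smooth_accel_coef.
have sH i j : continuous (fun x => hessian u x i j).
  under eq_fun do rewrite mxE.
  by apply: smooth_continuous; do 2!apply: smooth_derive.
have cHC : continuous (fun x => (\sum_i \sum_j `|hessian u x i j|) * \sum_j `|C j x|).
  have csum (F : 'I_n -> V -> R) : (forall i, continuous (F i)) ->
      continuous (fun x => \sum_i F i x).
    by move=> cF x; exact: (@Ck_on_sum R V R 0 setT n F openT (fun i y _ => cF i y) x I).
  have c1 : continuous (fun x => \sum_i \sum_j `|hessian u x i j|).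
    apply: (csum (fun i x => \sum_j `|hessian u x i j|)) => i.
    apply: (csum (fun j x => `|hessian u x i j|)) => j y.
    exact: (cvg_norm (sH i j y)).
  have c2 : continuous (fun x => \sum_j `|C j x|).
    by apply: (csum (fun j x => `|C j x|)) => j y; exact: (cvg_norm (sC j y)).
  by move=> x; exact: (cvgM (c1 x) (c2 x)).
have [B B0 hB] := compact_continuous_bound _ K _ cK cHC.
exists B => // x v Kx.
apply: rV_norm_le => [|j]; first by rewrite mulr_ge0 ?esq_ge0 // ltW.
rewrite geodesic_accel_coord -/(C j x) normrM.
apply: (@le_trans _ _ ((\sum_i \sum_j `|hessian u x i j|) * esq v * \sum_j `|C j x|)).
  apply: ler_pM => //; first exact: quad_bound.
  by rewrite (bigD1 j) //= lerDl sumr_ge0.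
rewrite mulrAC ler_wpM2r ?esq_ge0 //.
exact: le_trans (ler_norm _) (hB x Kx).
Qed.

(** [d] is the minimum of the Hessian form over [K] times the Euclidean unit sphere; homogeneity
    extends the bound to all [v]. *)
Lemma hessian_lower_bound (f : V -> R) (K : set V) : compact K -> (0 < n)%N ->
  strictly_convex f ->
  exists2 d, 0 < d & forall x v, K x -> d * esq v <= (v *m hessian f x *m v^T) 0 0.
Proof.
move=> cK n0 [sf pf].
have [[x0 Kx0]|noK] := pselect (K !=set0); last first.
  by exists 1 => // x v Kx; case: noK; exists x.
pose S := [set v : V | esq v = 1].
have cE : continuous esq.
  apply: (@smooth_continuous V R) => k; apply: Ck_on_sum => [|i]; first exact: openT.
  under eq_fun do rewrite expr2.
  by apply: Ck_onM; first exact: openT; apply: (@Ck_on_coord _ _ _ _ _ id);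
    try exact: openT; exact: Ck_on_id.
have cS : compact S.
  apply: bounded_closed_compact.
    exists 1; split=> [|x lt1 v /= v1]; first exact: num_real.
    by apply: le_trans (norm_le_sqrt_esq v) _; rewrite v1 sqrtr1 ltW.
  exact: (@closed_comp _ _ esq [set x | x = 1] (fun v _ => cE v) (@closed_eq _ 1)).
pose q (z : V * V) := (z.2 *m hessian f z.1 *m z.2^T) 0 0.
have cq : continuous q.
  have c1 : Ck_on 0 setT (fst : V * V -> V) by move=> z _; exact: cvg_fst.
  have c2 : Ck_on 0 setT (snd : V * V -> V) by move=> z _; exact: cvg_snd.
  suff h k : Ck_on k setT (fst : V * V -> V) -> Ck_on k setT (snd : V * V -> V) ->
      Ck_on k setT q by move=> z; exact: (h 0%N c1 c2 z I).
  move=> {}c1 {}c2; rewrite /q; under eq_fun do rewrite quad_formE.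
  apply: Ck_on_sum => [|i]; first exact: openT.
  apply: Ck_on_sum => [|j]; first exact: openT.
  apply: Ck_onM; [exact: openT| |by apply: Ck_on_coord => //; exact: openT].
  apply: Ck_onM; [exact: openT| |by apply: Ck_on_coord => //; exact: openT].
  under eq_fun do rewrite mxE.
  apply: (@Ck_on_comp R _ k setT n setT
    (fun x => 'D_(coord_vec i) (fun y => 'D_(coord_vec j) f y) x) fst) => //.
    exact: openT.
  by do 2!apply: smooth_derive.
have ne : (K `*` S) !=set0.
  exists (x0, coord_vec (Ordinal n0)); split=> //=.
  rewrite /S /= /esq (bigD1 (Ordinal n0)) //= mxE !eqxx expr1n big1 ?addr0 // => i i0.
  by rewrite mxE (negPf i0) andbF expr0n.
have [z zin zmin] := compact_EVT_min ne (compact_setX cK cS) (continuous_subspaceT cq).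
have [Kz Sz] : K z.1 /\ S z.2 by move: zin; rewrite inE => -[].
exists (q z).
  apply: pf; apply/eqP => z20; move: Sz; rewrite /S /= z20 /esq big1.
    by move/eqP; rewrite eq_sym oner_eq0.
  by move=> i _; rewrite mxE expr0n.
move=> x v Kx; have [->|v0] := eqVneq v 0.
  rewrite mul0mx mul0mx mxE /esq big1 ?mulr0 // => i _.
  by rewrite mxE expr0n.
have e0 := esq_gt0 v v0; have r0 : 0 < Num.sqrt (esq v) by rewrite sqrtr_gt0.
pose w := (Num.sqrt (esq v))^-1 *: v.
have Sw : S w by rewrite /S /= esqZ exprVn sqr_sqrtr ?ltW // mulVf // gt_eqF.
have := zmin (x, w); rewrite inE => /(_ (conj Kx Sw)).
have scal (a : R) : (a *: v) *m hessian f x *m (a *: v)^T =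
    (a * a) *: (v *m hessian f x *m v^T).
  by rewrite [(a *: v)^T]linearZ /= -!scalemxAl -scalemxAr scalerA.
rewrite {2}/q /= /w scal mxE -expr2 exprVn.
by rewrite sqr_sqrtr ?(ltW e0) // mulrC ler_pdivlMr.
Qed.

End Accel.

(** * Estimates along solutions for u = s o f *)

Section Composite.
Context {R : realType} (n : nat).
Hypothesis n_gt0 : (0 < n)%N.
Local Notation V := 'rV[R]_n.
Context (A : set R) (s : R -> R) (f : V -> R).
Hypothesis A_ge0 : `[0, +oo[ `<=` A.
Hypothesis ss : smooth_on A s.
Hypothesis ds_le1 : forall t : R, 0 <= t -> `|'D_1 s t| <= 1.
Hypothesis f_ge0 : forall x, 0 <= f x.
Hypothesis f_convex : strictly_convex f.
Hypothesis f_proper : proper_map setT setT f.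
Hypothesis f_mnorm : forall x, -1 < mnorm n (grad n f x).

Let u := s \o f.
Let s1 t := 'D_1 s t.
Let s2 t := 'D_1 s1 t.
Let sf : smooth_on setT f. Proof. by case: f_convex. Qed.
Let Af x : A (f x). Proof. by apply: A_ge0; rewrite /= in_itv /= f_ge0. Qed.
Let N x := mnorm n (grad n f x).
Let a x := mnorm n (grad n u x).

Let df x : differentiable f x. Proof. exact: smooth_differentiable sf I. Qed.

Let ss1 : smooth_on A s1. Proof. exact: smooth_derive. Qed.

Lemma smooth_comp (g : R -> R) : smooth_on A g -> smooth_on setT (g \o f).
Proof.
move=> sg k; apply: (@Ck_on_comp_R _ _ k setT A) => //; exact: openT.
Qed.

Let su : smooth_on setT u. Proof. exact: smooth_comp. Qed.

Let D_comp (g : R -> R) w x : smooth_on A g ->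
  'D_w (g \o f) x = 'D_1 g (f x) * 'D_w f x.
Proof. by move=> sg; apply: derive_comp_R => //; exact: smooth_differentiable sg (Af x). Qed.

Lemma grad_comp x : grad n u x = s1 (f x) *: grad n f x.
Proof. by apply/colP => i; rewrite !mxE D_comp. Qed.

Lemma hessian_comp x : hessian u x =
  s2 (f x) *: (grad n f x *m (grad n f x)^T) + s1 (f x) *: hessian f x.
Proof.
apply/matrixP => i j; rewrite !mxE big_ord1 !mxE.
have -> : (fun y => 'D_(coord_vec j) u y) = (s1 \o f) * (fun y => 'D_(coord_vec j) f y).
  by apply/funext => y; exact: D_comp.
rewrite deriveM; last 2 first.
- by apply/diff_derivable/smooth_differentiable; [exact: smooth_comp|].
- by apply/diff_derivable/smooth_differentiable; [exact: smooth_derive sf|].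
rewrite D_comp // addrC; congr (_ + _).
by rewrite [LHS]mulrC -mulrA.
Qed.

Lemma mnorm_grad_comp x : a x = s1 (f x) ^+ 2 * N x.
Proof. by rewrite /a grad_comp mnormZ. Qed.

Lemma mnorm_grad_comp_gt x : -1 < a x.
Proof.
rewrite mnorm_grad_comp; have := f_mnorm x; rewrite -/(N x) => N1.
have s_le1 : s1 (f x) ^+ 2 <= 1.
  by rewrite -[leLHS]real_normK ?num_real // expr_le1 // ds_le1.
case: (leP 0 (N x)) => N0; first by rewrite (lt_le_trans (ltrN10 R)) // mulr_ge0 ?sqr_ge0.
apply: (lt_le_trans N1); rewrite -[leLHS]mul1r ler_wnM2r //; exact: ltW.
Qed.

(** The left-hand side is the second derivative of [f] along a curve with velocity [v] and
    acceleration [chi] times the geodesic one. Hess u splits into an [s2] part and an [s1] part; the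
    latter meets the factor [s1] of grad u and produces [a x]. *)
Lemma second_derivative_along x v chi :
  (v *m hessian f x *m v^T) 0 0 + 'D_(chi *: geodesic_accel n u x v) f x =
  (v *m hessian f x *m v^T) 0 0 * (1 - chi * (a x / (1 + a x)))
  - chi * (s1 (f x) * s2 (f x) * N x / (1 + a x)) * ('D_v f x) ^+ 2.
Proof.
have a0 : 1 + a x != 0 by rewrite gt_eqF //; have := mnorm_grad_comp_gt x; lra.
set Q := (v *m hessian f x *m v^T) 0 0.
have DfE w : 'D_w f x = (w *m grad n f x) 0 0.
  by rewrite derive_sum_coord // mxE; apply: eq_bigr => i _; rewrite mxE mulrC.
have QuE : (v *m hessian u x *m v^T) 0 0 = s2 (f x) * ('D_v f x) ^+ 2 + s1 (f x) * Q.
  rewrite hessian_comp mulmxDr mulmxDl -!scalemxAr -!scalemxAl.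
  rewrite mxE [X in X + _ = _]mxE [X in _ + X = _]mxE -/Q; congr (_ * _ + _).
  have -> : v *m (grad n f x *m (grad n f x)^T) *m v^T =
      (v *m grad n f x) *m (v *m grad n f x)^T by rewrite trmx_mul !mulmxA.
  by rewrite mxE big_ord1 [X in _ * X]mxE -DfE expr2.
have -> : 'D_(chi *: geodesic_accel n u x v) f x =
    - chi * ((s2 (f x) * ('D_v f x) ^+ 2 + s1 (f x) * Q) / (1 + a x)) * s1 (f x) * N x.
  rewrite DfE /geodesic_accel QuE -/(a x) -scalemxAl scalemxAl grad_comp.
  rewrite [(_ *: grad n f x)^T]linearZ /= -!scalemxAl mnormE !mxE eqxx mulr1n -/(N x).
  by move: (_ / (1 + a x)) => X; ring.
rewrite mnorm_grad_comp in a0 *.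
by field.
Qed.

(** Truncation to [0, 1], written with absolute values so that continuity is immediate. *)
Definition clamp (r : R) : R := (1 + `|r| - `|r - 1|) / 2.

Lemma clamp_itv r : 0 <= clamp r <= 1.
Proof.
by rewrite /clamp; case: (ger0P r) => r0; case: (ger0P (r - 1)) => r1; lra.
Qed.

Lemma clamp0 r : r <= 0 -> clamp r = 0.
Proof. by move=> r0; rewrite /clamp ler0_norm // ler0_norm; lra. Qed.

Lemma clamp1 r : 1 <= r -> clamp r = 1.
Proof. by move=> r1; rewrite /clamp ger0_norm ?ger0_norm; lra. Qed.

Lemma clamp_continuous : continuous clamp.
Proof.
move=> r; apply: cvgM; last exact: cvg_cst.
apply: cvgB.
  by apply: cvgD; [exact: cvg_cst|exact: norm_continuous].
by apply: cvg_norm; apply: cvgB; [exact: cvg_id|exact: cvg_cst].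
Qed.

Lemma esq_le_norm (v : V) : esq n v <= n%:R * `|v| ^+ 2.
Proof.
apply: (@le_trans _ _ (\sum_(i < n) `|v| ^+ 2)).
  apply: ler_sum => i _; rewrite -real_normK ?num_real // lerXn2r ?nnegrE //.
  exact: coord_le_norm.
by rewrite sumr_const card_ord mulr_natl.
Qed.

(** The right-hand side is (1 - chi) + chi / (1 + b), and both 1 and 1 / (1 + b) are at least 1 /
    M. *)
Lemma cutoff_factor_ge (chi b M : R) : 0 <= chi <= 1 -> -1 < b -> 1 + b <= M -> 1 <= M ->
  M^-1 <= 1 - chi * (b / (1 + b)).
Proof.
move=> /andP[c0 c1] b1 bM M1; have b0 : 0 < 1 + b by lra.
have M0 : 0 < M by lra.
have -> : 1 - chi * (b / (1 + b)) = (1 + (1 - chi) * b) / (1 + b).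
  by field; rewrite gt_eqF.
rewrite ler_pdivlMr // mulrC ler_pdivrMr //.
case: (lerP 0 b) => hb.
  have : 0 <= (1 - chi) * b by rewrite mulr_ge0 // subr_ge0.
  by nra.
have : b <= (1 - chi) * b by nra.
by nra.
Qed.

Let sublevel c := [set x : V | f x <= c].

Lemma sublevel_compact c : compact (sublevel c).
Proof.
have -> : sublevel c = [set: V] `&` f @^-1` `[0, c]%classic.
  apply/seteqP; split=> x; rewrite /sublevel /= in_itv /= f_ge0 //=.
  by case.
exact: f_proper (@segment_compact R 0 c).
Qed.

Let hess_quad (x v : V) : R := (v *m hessian f x *m v^T) 0 0.

Lemma is_derive_along (x v : R -> V) (t : R) g :
  is_derive t 1 x (v t) -> is_derive t 1 v g ->
  is_derive t 1 (fun t => 'D_(v t) f (x t)) (hess_quad (x t) (v t) + 'D_g f (x t)).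
Proof.
move=> dx dv.
have -> : (fun t => 'D_(v t) f (x t)) =
    \sum_(i < n) ((fun y => 'D_(coord_vec i) f y) \o x) * (fun t => v t 0 i).
  by apply/funext => z; rewrite derive_sum_coord // fct_sumE.
have dD (i : 'I_n) y : differentiable (fun y => 'D_(coord_vec i) f y) y.
  exact: smooth_differentiable (smooth_derive _ _ _ _ _ sf) I.
have d i := is_deriveM (is_derive_curve n _ x t (v t) (dD i (x t)) dx)
  (is_derive_coord n v t g i dv).
apply: is_derive_eq (is_derive_sum d) _.
rewrite big_split /= addrC [in RHS]derive_sum_coord //; congr (_ + _).
rewrite /hess_quad quad_formE exchange_big /=; apply: eq_bigr => i _.
rewrite (derive_sum_coord n _ (x t) (v t) (dD i (x t))).
rewrite [LHS]mulr_sumr; apply: eq_bigr => j _.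
by rewrite mxE mulrC.
Qed.

(** On [1, 2] the solution of the cut-off equation satisfies [f (x t) <= c] and [|v t| <= L]. The
    cutoff is 1 up to [c + 1] and [L + 1], so by continuity the true equation holds on a
    neighbourhood of each time, end points included. *)
Lemma bvp_graph (p q : V) : exists x v : R -> V,
  [/\ forall t0 : R, 1 <= t0 <= 2 -> \forall t \near t0,
        is_derive (t : R) 1 x (v t) /\
        is_derive (t : R) 1 v (geodesic_accel n u (x t) (v t)),
      x 1 = p & x 2 = q].
Proof.
pose c := Num.max (f p) (f q).
have fp : f p <= c by rewrite le_max lexx.
have fq : f q <= c by rewrite le_max lexx orbT.
have c0 : 0 <= c by apply: le_trans fp.
(* The cutoff vanishes outside this compact set, so all constants can be taken from it. *)
pose K2 := sublevel (c + 2).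
have cK2 : compact K2 by exact: sublevel_compact.
have a1 : forall x, -1 < a x by exact: mnorm_grad_comp_gt.
have sa : smooth_on setT a by exact: smooth_mnorm_grad.
have a10 x : 1 + a x != 0 by rewrite gt_eqF //; have := a1 x; lra.
pose rho x := s1 (f x) * s2 (f x) * N x / (1 + a x).
have sa1 : smooth_on setT (fun x => 1 + a x).
  by move=> k; apply: Ck_onD; [exact: openT|exact: Ck_on_cst|exact: sa].
have srho : smooth_on setT rho.
  move=> k; apply: Ck_onM; first exact: openT.
    apply: Ck_onM; first exact: openT.
      apply: Ck_onM; first exact: openT.
        exact: (smooth_comp s1 ss1 k).
      by apply: (smooth_comp s2 _ k); exact: smooth_derive.
    exact: smooth_mnorm_grad.
  by apply: Ck_onV => //; exact: openT.
have [Kr Kr0 rhoK] := compact_continuous_bound _ K2 rho cK2 (smooth_continuous _ _ _ srho).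
have [M' M'0 aM'] := compact_continuous_bound _ K2 _ cK2 (smooth_continuous _ _ _ sa1).
pose M := M' + 1.
have [d1 d10 hessK] := hessian_lower_bound n f K2 cK2 n_gt0 f_convex.
have [B0 B00 accK] := geodesic_accel_bound n u K2 cK2 su a1.
have M1 : 1 <= M by rewrite lerDr ltW.
have M0 : 0 < M by apply: lt_le_trans M1.
pose B := n%:R * B0.
have nR : 0 < n%:R :> R by rewrite ltr0n.
have B1 : 0 < B by rewrite mulr_gt0.
(* From [w2 t = w t * Kr * (r t + Kr * pp t ^+ 2)], with [w t >= 1] and the last factor at least
   [d1 / M * esq n (v t)]. *)
pose c1 := Kr * (d1 / M).
have c10 : 0 < c1 by rewrite mulr_gt0 // divr_gt0.
pose W := expR (Kr * c).
(* None of [c1], [B], [W] refers to the velocity cutoff, so [L] may be used to define it. *)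
pose L := Num.sqrt (speed_bound c1 B W).
pose chi (z : V * V) := clamp (c + 2 - f z.1) * clamp (L + 2 - `|z.2|).
have chi01 z : 0 <= chi z <= 1.
  have := clamp_itv (c + 2 - f z.1); have := clamp_itv (L + 2 - `|z.2|).
  move=> /andP[h1 h2] /andP[h3 h4]; apply/andP; split; first exact: mulr_ge0.
  by rewrite mulr_ile1.
pose G x v := chi (x, v) *: geodesic_accel n u x v.
have cG : continuous (fun z : V * V => G z.1 z.2).
  have cf1 (z : V * V) : (fun z : V * V => clamp (c + 2 - f z.1)) @ z --> clamp (c + 2 - f z.1).
    have h : (fun z : V * V => c + 2 - f z.1) @ z --> c + 2 - f z.1.
      apply: cvgB; first exact: cvg_cst.
      by apply: (cvg_comp _ _ (@cvg_fst _ _ _ _ _)); exact: (smooth_continuous _ _ _ sf).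
    exact: (cvg_comp _ _ h (@clamp_continuous _)).
  have cf2 (z : V * V) : (fun z : V * V => clamp (L + 2 - `|z.2|)) @ z --> clamp (L + 2 - `|z.2|).
    have h : (fun z : V * V => L + 2 - `|z.2|) @ z --> L + 2 - `|z.2|.
      apply: cvgB; first exact: cvg_cst.
      by apply: (cvg_comp _ _ (@cvg_snd _ _ _ _ _)); exact: norm_continuous.
    exact: (cvg_comp _ _ h (@clamp_continuous _)).
  have ca k : Ck_on k setT (fst : V * V -> V) -> Ck_on k setT (snd : V * V -> V) ->
      Ck_on k setT (fun z : V * V => geodesic_accel n u z.1 z.2).
    by move=> h1 h2; apply: Ck_geodesic_accel => //; exact: openT.
  have ca0 := ca 0%N (fun z _ => @cvg_fst _ _ _ _ _) (fun z _ => @cvg_snd _ _ _ _ _).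
  move=> z.
  have cm : (fun z : V * V => clamp (c + 2 - f z.1) * clamp (L + 2 - `|z.2|)) @ z -->
      clamp (c + 2 - f z.1) * clamp (L + 2 - `|z.2|).
    by apply: cvgM; [exact: cf1|exact: cf2].
  have cz : (fun z : V * V => geodesic_accel n u z.1 z.2) @ z --> geodesic_accel n u z.1 z.2.
    exact: ca0 z I.
  exact: (cvgZ cm cz).
have chi_out x v : c + 2 <= f x -> chi (x, v) = 0.
  by move=> h; rewrite /chi /= clamp0 ?mul0r // subr_le0.
have chi_in x v : f x <= c + 1 -> `|v| <= L + 1 -> chi (x, v) = 1.
  by move=> h1 h2; rewrite /chi /= !clamp1 ?mulr1 //; lra.
have bG x v : `|G x v| <= B0 * (n%:R * (L + 2) ^+ 2).
  have L0 : 0 <= L by exact: sqrtr_ge0.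
  have r0 : 0 <= B0 * (n%:R * (L + 2) ^+ 2).
    by rewrite mulr_ge0 ?(ltW B00) // mulr_ge0 // sqr_ge0.
  case: (leP (c + 2) (f x)) => h1; first by rewrite /G chi_out // scale0r normr0.
  case: (leP (L + 2) `|v|) => h2.
    by rewrite /G /chi /= [clamp (L + 2 - _)]clamp0 ?subr_le0 // mulr0 scale0r normr0.
  rewrite /G normrZ; have /andP[q1 q2] := chi01 (x, v).
  rewrite (ger0_norm q1); apply: (@le_trans _ _ (1 * (B0 * esq n v))).
    by apply: ler_pM => //; apply: accK; exact: ltW.
  rewrite mul1r ler_wpM2l ?(ltW B00) //; apply: le_trans (esq_le_norm v) _.
  rewrite ler_wpM2l // lerXn2r ?nnegrE ?(ltW h2) //.
  by rewrite addr_ge0.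
have [x [v [dx dv x1 x2]]] := bvp_solution n G _ cG bG p q n_gt0.
exists x, v; split=> //.
pose pp (t : R) := 'D_(v t) f (x t).
pose r (t : R) := hess_quad (x t) (v t) + 'D_(G (x t) (v t)) f (x t).
have dy (t : R) : 0 < t -> is_derive t 1 (f \o x) (pp t).
  by move=> t0; apply: is_derive_curve => //; exact: dx.
have dp (t : R) : 0 < t -> is_derive t 1 pp (r t).
  by move=> t0; apply: is_derive_along; [exact: dx|exact: dv].
have rE (t : R) : r t = hess_quad (x t) (v t) * (1 - chi (x t, v t) * (a (x t) / (1 + a (x t))))
    - chi (x t, v t) * rho (x t) * pp t ^+ 2.
  exact: second_derivative_along.
have r_in (t : R) : f (x t) <= c + 2 -> d1 / M * esq n (v t) <= r t + Kr * pp t ^+ 2.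
  move=> ft; rewrite rE.
  have /andP[q1 q2] := chi01 (x t, v t).
  have h1 : chi (x t, v t) * rho (x t) * pp t ^+ 2 <= Kr * pp t ^+ 2.
    rewrite ler_wpM2r ?sqr_ge0 //; apply: le_trans (ler_norm _) _; rewrite normrM ger0_norm //.
    by rewrite -[leRHS]mul1r ler_pM // rhoK.
  have h2 : d1 / M * esq n (v t) <= hess_quad (x t) (v t) *
      (1 - chi (x t, v t) * (a (x t) / (1 + a (x t)))).
    rewrite mulrAC; apply: ler_pM.
    - by rewrite mulr_ge0 ?esq_ge0 // ltW.
    - by rewrite invr_ge0 ltW.
    - exact: hessK.
    - apply: cutoff_factor_ge => //.
      by have := aM' (x t) ft; rewrite ler_norml /M; lra.
  lra.
(* This holds even if the curve leaves [K2]: there [chi] vanishes and [r t] is a value of the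
   Hessian form of [f]. So [w] is convex before the curve is known to be confined. *)
have r_ge (t : R) : 0 <= r t + Kr * pp t ^+ 2.
  case: (leP (f (x t)) (c + 2)) => ft.
    by apply: le_trans (r_in t ft); rewrite mulr_ge0 ?esq_ge0 // divr_ge0 // ltW.
  rewrite rE chi_out ?(ltW ft) // !mul0r !subr0 mulr1 addr_ge0 //.
    case: f_convex => _ pf; rewrite /hess_quad.
    have [->|v0] := eqVneq (v t) 0; first by rewrite !mul0mx mxE.
    by apply: ltW; exact: pf.
  by rewrite mulr_ge0 ?sqr_ge0 // ltW.
pose w (t : R) := expR (Kr * f (x t)).
pose w1 (t : R) := w t * (Kr * pp t).
pose w2 (t : R) := w t * Kr * (r t + Kr * pp t ^+ 2).
have w0 (t : R) : 0 < w t by exact: expR_gt0.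
have pos (t : R) : 1 <= t <= 2 -> 0 < t by move=> h; lra.
have dw (t : R) : 1 <= t <= 2 -> is_derive t 1 w (w1 t).
  move=> h; apply: (@is_derive1_comp R (@expR R) (fun t => Kr * f (x t))).
  by apply: (is_deriveZ Kr); apply: dy; exact: pos.
have dw1 (t : R) : 1 <= t <= 2 -> is_derive t 1 w1 (w2 t).
  move=> h; apply: is_derive_eq (is_deriveM (dw t h) (is_deriveZ Kr (dp t (pos t h)))) _.
  change (w t * (Kr * r t) + (Kr * pp t) * w1 t = w2 t).
  by rewrite /w2 /w1; ring.
have w2_ge0 (t : R) : 1 <= t <= 2 -> 0 <= w2 t.
  by move=> _; rewrite mulr_ge0 // mulr_ge0 // ltW.
have wW (t : R) : 1 <= t <= 2 -> w t <= W.
  apply: (convex_le_max w w1 w2) => //.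
    by rewrite /w x1 ler_expR ler_pM2l.
  by rewrite /w x2 ler_expR ler_pM2l.
have fc (t : R) : 1 <= t <= 2 -> f (x t) <= c.
  by move=> /wW; rewrite /w /W ler_expR ler_pM2l.
have dv12 (t : R) : 1 <= t <= 2 -> is_derive t 1 v (G (x t) (v t)).
  by move=> h; apply: dv; exact: pos.
have speed (t : R) : 1 <= t <= 2 -> esq n (v t) <= speed_bound c1 B W.
  apply: (speed_bound_segment (fun t => esq n (v t))
    (fun t => \sum_i 2 * (v t 0 i * G (x t) (v t) 0 i)) w w1 w2) => //.
  - by move=> {}t h; apply: is_derive_esq; exact: dv12.
  - by move=> {}t _; exact: esq_ge0.
  - move=> {}t h; apply: norm_derive_esq; rewrite normrZ.
    have /andP[q1 q2] := chi01 (x t, v t).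
    rewrite (ger0_norm q1) -[leRHS]mul1r; apply: ler_pM => //.
    by apply: accK; rewrite /K2 /sublevel /=; have := fc t h; lra.
  - move=> {}t h; rewrite /c1 /w2 -mulrA mulrA.
    have h1 : d1 / M * esq n (v t) <= r t + Kr * pp t ^+ 2.
      by apply: r_in; have := fc t h; lra.
    have h2 : 1 <= w t.
      by rewrite /w -expR0 ler_expR mulr_ge0 // ltW.
    rewrite -!mulrA -[leLHS]mul1r; apply: ler_pM => //.
      by rewrite !mulr_ge0 ?invr_ge0 ?esq_ge0 // ltW.
    by rewrite ler_pM2l // mulrA.
  - by move=> {}t h; rewrite wW // ltW.
move=> t0 t012.
have t00 := pos t0 t012.
have cx : {for t0, continuous x}.
  by apply: differentiable_continuous; apply/derivable1_diffP; have [] := dx t0 t00.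
have cv : {for t0, continuous v}.
  by apply: differentiable_continuous; apply/derivable1_diffP; have [] := dv t0 t00.
have n1 : \forall t \near t0, 0 < t by exact: lt_nbhsr.
have n2 : \forall t \near t0, f (x t) < c + 1.
  have h : (fun t => f (x t)) @ t0 --> f (x t0).
    exact: (cvg_comp _ _ cx (smooth_continuous _ _ _ sf (x t0))).
  apply: (cvgr_lt (f (x t0)) h); have := fc t0 t012; lra.
have n3 : \forall t \near t0, `|v t| < L + 1.
  apply: (cvgr_lt `|v t0| (cvg_norm cv)).
  apply: (@le_lt_trans _ _ L); last by rewrite ltrDl.
  apply: le_trans (norm_le_sqrt_esq n (v t0)) _.
  by apply: ler_wsqrtr; exact: speed.
move: n1 n2 n3; apply: filterS3 => t h1 h2 h3; split; first exact: dx.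
by have := dv t h1; rewrite /G chi_in ?scale1r // ltW.
Qed.

End Composite.

(** * From the estimates to the theorem *)

Lemma derive1_within_ge0 (R : realType) (s sigma : R -> R) (t : R) : 0 <= t ->
  (forall r : R, 0 <= r -> s r = sigma r) -> differentiable s t ->
  derive1_within `[0, +oo[ sigma t = 'D_1 s t.
Proof.
move=> t0 ssig ds; rewrite -derive1E /derive1_within.
have dc : (fun h => h^-1 *: (s (h + t) - s t)) @ 0^' --> derive1 s t.
  have /derivable1_diffP := ds; rewrite /derivable /derive1.
  suff -> : (fun h : R => h^-1 *: ((s \o shift t) (h *: 1) - s t)) =
    (fun h => h^-1 *: (s (h + t) - s t)) by [].
  by apply/funext => h; rewrite /= [h *: 1]mulr1.
set F := within _ _.
(* Uniqueness of the limit needs a proper filter; small positive increments stay in the half-line,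
   also at [t = 0]. *)
have PF : ProperFilter F.
  apply: Build_ProperFilter_ex => P [e /= e0 he].
  exists (e / 2); apply: he => /=.
  - by rewrite sub0r normrN gtr0_norm ?divr_gt0 // ltr_pdivrMr // ltr_pMr // ltr1n.
  - by rewrite gt_eqF // divr_gt0.
  - by rewrite in_itv /= andbT addr_ge0 // divr_ge0 // ltW.
apply: cvg_lim => //.
apply: (@cvg_trans _ ((fun h => h^-1 *: (s (h + t) - s t)) @ F)).
  apply: near_eq_cvg; rewrite /F near_withinE.
  by apply: filterE => h; rewrite /= in_itv /= andbT => ht; rewrite !ssig.
by apply: cvg_trans dc; apply: cvg_app; exact: cvg_within.
Qed.

Lemma is_derive_shift_arg (R : realType) (V : normedModType R) (g : R -> V) (t k : R) (d : V) :
  is_derive (t + k) 1 g d -> is_derive t 1 (fun t => g (t + k)) d.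
Proof.
have E : (fun h : R => h^-1 *: (((fun t => g (t + k)) \o shift t) (h *: 1) - g (t + k))) =
   (fun h => h^-1 *: ((g \o shift (t + k)) (h *: 1) - g (t + k))).
  by apply/funext => h /=; rewrite addrA.
by move=> [h1 h2]; split; [rewrite /derivable E|rewrite /derive E].
Qed.

(** The graph map is a global chart, in which the curve reads [x] at every time; only the interval
    depends on [t0]. *)
Lemma geodesic_segment_graph (R : realType) (n : nat) (u : 'rV[R]_n -> R)
    (x v : R -> 'rV[R]_n) :
  (0 < n)%N -> smooth_on setT u -> (forall y, -1 < mnorm n (grad n u y)) ->
  (forall t0 : R, 0 <= t0 <= 1 -> \forall t \near t0,
     is_derive (t : R) 1 x (v t) /\ is_derive (t : R) 1 v (geodesic_accel n u (x t) (v t))) ->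
  geodesic_segment n (graph u) (fun t => graph_map n u (x t)).
Proof.
move=> n0 su N1 hx t0 /hx /nbhs_ballP[d /= d0 hd].
pose I := ball t0 d.
have dx (t : R) : I t -> is_derive t 1 x (v t) by move=> /hd[].
have dv (t : R) : I t -> is_derive t 1 v (geodesic_accel n u (x t) (v t)) by move=> /hd[].
have oI : open I by exact: ball_open.
exists setT, (graph_map n u), I, x; split.
- exact: local_param_graph_map.
- by split => //; exact: ballxx.
- exact: (ode_smooth n I u x v).
- move=> t It _; split=> //.
  have xE z : I z -> derive1 x z = v z.
    by move=> Iz; rewrite derive1E; have [_ ->] := dx z Iz.
  apply: (geodesic_equation_graph n n0 u x t (v t)) => //; first exact: xE.
  rewrite derive1nS derive1n1 derive1E.
  have -> : 'D_1 (derive1 x) t = 'D_1 v t.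
    apply: near_eq_derive.
    by have : nbhs t I by [exact: open_nbhs_nbhs]; apply: filterS => z; exact: xE.
  by have [_ ->] := dv t It.
Qed.

Theorem corollary7p5 (R : realType) (n : nat) (n_gt0 : (0 < n)%N)
    (sigma : R -> R) (f : 'rV[R]_n -> R)
    (sigma_ge0 : forall t : R, 0 <= t -> 0 <= sigma t)
    (sigma_proper : proper_map (`[0, +oo[ : set R) (`[0, +oo[ : set R) sigma)
    (sigma_smooth : smooth_within (`[0, +oo[ : set R) sigma)
    (sigma_deriv : forall t : R, 0 <= t ->
       0 < derive1_within `[0, +oo[ sigma t <= 1)
    (f_proper : proper_map setT setT f)
    (f_ge0 : forall x, 0 <= f x)
    (f_convex : strictly_convex f)
    (f_lorentzian : lorentzian_function f) :
  timelike_hypersurface (graph (sigma \o f)) /\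
  geodesically_connected n (graph (sigma \o f)).
Proof.
have [A [s [oA A_ge0 ss ssig]]] := sigma_smooth.
have {}ssig t : 0 <= t -> s t = sigma t.
  by move=> t0; apply: ssig; rewrite /= in_itv /= t0.
have As t : 0 <= t -> A t by move=> t0; apply: A_ge0; rewrite /= in_itv /= t0.
(* As [f] is nonnegative, [sigma] may be replaced by its extension [s], smooth on an open set
   containing the half-line. *)
have -> : sigma \o f = s \o f by apply/funext => x /=; rewrite ssig.
have ds_le1 t : 0 <= t -> `|'D_1 s t| <= 1.
  move=> t0; have := sigma_deriv t t0.
  rewrite (derive1_within_ge0 R s) //; last exact: smooth_differentiable ss (As t t0).
  by move=> /andP[h1 h2]; rewrite gtr0_norm.
have [sf _] := f_convex.
have fN x : -1 < mnorm n (grad n f x).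
  by case: f_lorentzian => _; exact: timelike_graph_mnorm.
have su : smooth_on setT (s \o f) by exact: (smooth_comp n A).
have uN x : -1 < mnorm n (grad n (s \o f) x) by exact: (mnorm_grad_comp_gt n A).
split; first exact: timelike_graph.
move=> p q [x0 _ <-] [x1 _ <-].
have [x [v [dxv e0 e1]]] := bvp_graph n n_gt0 A s f A_ge0 ss ds_le1 f_ge0 f_convex f_proper fN x0 x1.
(* The boundary value problem was solved on [1, 2]; geodesic segments are parametrized by [0, 1]. *)
exists (fun t => graph_map n (s \o f) (x (t + 1))); split.
- apply: (geodesic_segment_graph R n (s \o f) (fun t => x (t + 1)) (fun t => v (t + 1))) => //.
  move=> t0 t01.
  have c : (fun t : R => t + 1) @ t0 --> t0 + 1.
    by apply: cvgD; [exact: cvg_id|exact: cvg_cst].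
  have t12 : 1 <= t0 + 1 <= 2 by lra.
  have H : \forall t \near t0, is_derive (t + 1 : R) 1 x (v (t + 1)) /\
      is_derive (t + 1 : R) 1 v (geodesic_accel n (s \o f) (x (t + 1)) (v (t + 1))).
    exact: c _ (dxv _ t12).
  by move: H; apply: filterS => t [h1 h2]; split; exact: is_derive_shift_arg.
- by rewrite add0r e0.
- by rewrite (_ : 1 + 1 = 2) ?e1.
Qed.
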